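(* Let $n\ge2$ and $N\ge1$ be integers. There exist constants $\lambda,\Lambda>0$, a coefficient matrix $A=(A_{ij}^{\alpha\beta})\in C(\bar B_4)$ satisfying $$|A(x)|\le \Lambda \quad\text{for a.e. } x\in B_4,$$ $$\int_{B_4} A_{ij}^{\alpha\beta}\,\partial_\beta\varphi^j\,\partial_\alpha\varphi^i\,dx\ \ge\ \lambda\,\|\nabla\varphi\|_{L^2(B_4)}^2\quad\text{for all }\varphi\in H_0^1(B_4),$$ and $$\limsup_{r\to0}\ r\int_r^2\frac{\omega_{A,2}(t)}{t^2}\exp\Big(C_*\int_t^2\frac{\omega_{A,2}(s)}{s}\,ds\Big)\,dt=0,$$ and a solution $u\in H^1(B_4)$ of $$\partial_\alpha(A_{ij}^{\alpha\beta}\partial_\beta u^j)=0\quad\text{in }B_4,\quad i=1,\dots,N,$$ such that $\nabla u\in L^\infty(B_4)\cap VMO(B_4)$ but $\nabla u\notin C(B_2)$.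
   Context: $C_*=C_*(n,N,\Lambda,\lambda)>0$ is a given positive constant depending only on $n$, $N$, $\Lambda$ and $\lambda$. $B_r(x)$ is the ball in $\mathbb{R}^n$ with center $x$ and radius $r$, and $B_r=B_r(0)$. Functions $u=(u^1,\dots,u^N)$ and $\varphi=(\varphi^1,\dots,\varphi^N)$ are $\mathbb{R}^N$-valued. Repeated indices are summed, with $1\le\alpha,\beta\le n$ and $1\le i,j\le N$. Solutions are understood in the weak (distributional) sense. For $0<r\le2$, $(A)_{B_r(x)}=\frac{1}{|B_r(x)|}\int_{B_r(x)}A(y)\,dy$ and $$\omega_{A,2}(r)=\sup_{x\in B_2}\Big\{\frac{1}{|B_r(x)|}\int_{B_r(x)}|A(y)-(A)_{B_r(x)}|^2\,dy\Big\}^{1/2}.$$ $VMO$ denotes the usual space of functions of vanishing mean oscillation. $\nabla u\notin C(B_2)$ means that $\nabla u$ does not agree a.e. in $B_2$ with a continuous function. *)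

(* Defs.v *)
From HB Require Import structures.
From mathcomp Require Import all_boot all_order all_algebra.
From mathcomp Require Import all_classical all_reals all_analysis.

Set Implicit Arguments.
Unset Strict Implicit.
Unset Printing Implicit Defensive.

Import Order.TTheory GRing.Theory Num.Theory.
Import numFieldNormedType.Exports.

Local Open Scope classical_set_scope.
Local Open Scope ring_scope.

(* The sigma-algebra on row vectors is generated by the coordinates (as the
   library does for tuples); over a realType this is the Borel one. *)
Definition measure_rV_display : measure_display -> measure_display.
Proof. exact. Qed.

Section measurable_rV.
Context {d} {T : sigmaRingType d}.
Variable n : nat.

Let coors : 'I_n -> 'rV[T]_n -> T := fun i v => v ord0 i.

Let rV_set0 : g_sigma_preimage coors set0.
Proof. exact: sigma_algebra0. Qed.

Let rV_setC A : g_sigma_preimage coors A -> g_sigma_preimage coors (~` A).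
Proof. exact: sigma_algebraC. Qed.

Let rV_bigcup (F : _^nat) : (forall i, g_sigma_preimage coors (F i)) ->
  g_sigma_preimage coors (\bigcup_i (F i)).
Proof. exact: sigma_algebra_bigcup. Qed.

HB.instance Definition _ := @isMeasurable.Build (measure_rV_display d)
  'rV[T]_n (g_sigma_preimage coors) rV_set0 rV_setC rV_bigcup.

End measurable_rV.

Lemma measurable_rV_coord d (T : sigmaRingType d) n (i : 'I_n) :
  measurable_fun [set: 'rV[T]_n] (fun v => v ord0 i).
Proof.
move=> _ Y mY; rewrite setTI; apply: sub_sigma_algebra => /=.
rewrite -bigcup_seq/=; exists i => /=; first by rewrite mem_index_enum.
by exists Y => //; rewrite setTI.
Qed.

Lemma measurable_fun_rVP d1 d2 (T1 : measurableType d1) (T2 : measurableType d2)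
    n (f : T1 -> 'rV[T2]_n) :
  measurable_fun [set: T1] f <->
  forall i, measurable_fun [set: T1] (fun x => f x ord0 i).
Proof.
split=> [mf i|mf].
  exact: (measurableT_comp (measurable_rV_coord i) mf).
have sub : g_sigma_preimage (fun i x => f x ord0 i) `<=` measurable.
  apply: smallest_sub; first exact: sigma_algebra_measurable.
  case: n => [|n] in f mf *; first by rewrite big_ord0.
  rewrite -bigcup_mkord_ord; apply: bigcup_sub => i Ii.
  by move=> A [B mB <-]; exact: mf.
move=> _ A mA; apply: sub.
have /= -> := @g_sigma_preimage_comp _ T2 n 'rV[T2]_n (fun i v => v ord0 i) T1 f.
by exists A.
Qed.

Section lebesgue_rV.
Variable R : realType.

Definition rV_cons n (p : R * 'rV[R]_n) : 'rV[R]_n.+1 :=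
  \row_i (if unlift ord0 i is Some j then p.2 ord0 j else p.1).

Definition rV_uncons n (v : 'rV[R]_n.+1) : R * 'rV[R]_n :=
  (v ord0 ord0, \row_j v ord0 (lift ord0 j)).

Lemma rV_consK n : cancel (@rV_cons n) (@rV_uncons n).
Proof.
move=> [x v]; rewrite /rV_uncons /rV_cons; congr (_, _).
  by rewrite mxE unlift_none.
by apply/rowP => j; rewrite !mxE liftK.
Qed.

Lemma rV_unconsK n : cancel (@rV_uncons n) (@rV_cons n).
Proof.
move=> v; apply/rowP => i; rewrite mxE.
by case: unliftP => [j ->|->] //=; rewrite mxE.
Qed.

Lemma measurable_rV_cons n : measurable_fun [set: R * 'rV[R]_n] (@rV_cons n).
Proof.
apply/measurable_fun_rVP => i.
rewrite (_ : (fun x => _) = (fun p : R * 'rV[R]_n =>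
    if unlift ord0 i is Some j then p.2 ord0 j else p.1)); last first.
  by apply/funext => p; rewrite mxE.
case: (unlift ord0 i) => [j|]; last exact: measurable_fst.
exact: (measurableT_comp (measurable_rV_coord j) measurable_snd).
Qed.

Lemma measurable_rV_uncons n : measurable_fun [set: 'rV[R]_n.+1] (@rV_uncons n).
Proof.
apply/measurable_fun_pairP; split; first exact: measurable_rV_coord.
apply/measurable_fun_rVP => j.
rewrite (_ : (fun x => _) = (fun v : 'rV[R]_n.+1 => v ord0 (lift ord0 j))).
  exact: measurable_rV_coord.
by apply/funext => v; rewrite /= mxE.
Qed.

Section cons_measure.
Context {n : nat} (m : {sigma_finite_measure set 'rV[R]_n -> \bar R}).

Definition cons_measure : set 'rV[R]_n.+1 -> \bar R :=
  pushforward (@lebesgue_measure R \x m)%E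
    (@rV_cons n : measurableTypeR R * 'rV[R]_n -> 'rV[R]_n.+1).

Let cons_preim (A : set 'rV[R]_n.+1) : measurable A ->
  measurable (@rV_cons n @^-1` A : set (measurableTypeR R * 'rV[R]_n)).
Proof.
by move=> mA; rewrite -[X in measurable X]setTI; exact: measurable_rV_cons.
Qed.

Let cons_measure0 : cons_measure set0 = 0%E.
Proof. by rewrite /cons_measure /pushforward preimage_set0 measure0. Qed.

Let cons_measure_ge0 A : (0 <= cons_measure A)%E.
Proof. rewrite /cons_measure /pushforward; exact: measure_ge0. Qed.

Let cons_measure_sigma_additive : semi_sigma_additive cons_measure.
Proof.
move=> F mF tF mUF; rewrite /cons_measure /pushforward preimage_bigcup.
apply: measure_semi_sigma_additive.
- by move=> i; exact: cons_preim.
- apply/trivIsetP => /= i j _ _ ij; rewrite -preimage_setI.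
  by move/trivIsetP : tF => /(_ _ _ _ _ ij) ->//; rewrite preimage_set0.
- by rewrite -preimage_bigcup; exact: cons_preim.
Qed.

HB.instance Definition _ := isMeasure.Build _ _ _ cons_measure
  cons_measure0 cons_measure_ge0 cons_measure_sigma_additive.

Let cons_measure_sigma_finite : sigma_finite setT cons_measure.
Proof.
have /sigma_finiteP[F [FT ndF Foo]] := sigma_finiteT (@lebesgue_measure R).
have /sigma_finiteP[G [GT ndG Goo]] := sigma_finiteT m.
exists (fun k => @rV_uncons n @^-1` (F k `*` G k)).
  apply/esym; rewrite -preimage_bigcup -subTset => v _ /=.
  have : [set: R] (rV_uncons v).1 by [].
  have : [set: 'rV[R]_n] (rV_uncons v).2 by [].
  rewrite FT GT => -[j _ Gj] [i _ Fi]; exists (maxn i j) => //; split.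
    by move: Fi; exact/subsetPset/ndF/leq_maxl.
  by move: Gj; exact/subsetPset/ndG/leq_maxr.
move=> k; have [mF Fk] := Foo k; have [mG Gk] := Goo k.
have mFG : measurable (F k `*` G k : set (measurableTypeR R * 'rV[R]_n)).
  exact: measurableX.
split.
  by rewrite -[X in measurable X]setTI; exact: measurable_rV_uncons.
rewrite /cons_measure /pushforward -comp_preimage.
rewrite (_ : _ \o _ = id) ?preimage_id; last first.
  by apply/funext => p; exact: rV_consK.
by rewrite product_measure1E// lte_mul_pinfty// ge0_fin_numE.
Qed.

HB.instance Definition _ := Measure_isSigmaFinite.Build _ _ _ cons_measure
  cons_measure_sigma_finite.

End cons_measure.

(* n-dimensional Lebesgue measure (on Borel sets), as an iterated product. *)
Fixpoint lebesgue_rV n : {sigma_finite_measure set 'rV[R]_n -> \bar R} :=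
  match n with
  | 0 => \d_(0 : 'rV[R]_0)
  | n'.+1 => cons_measure (lebesgue_rV n')
  end.

Lemma lebesgue_rV_box n (A : 'I_n -> set R) : (forall i, measurable (A i)) ->
  lebesgue_rV n [set v | forall i, A i (v ord0 i)] =
  (\prod_(i < n) @lebesgue_measure R (A i))%E.
Proof.
elim: n A => [|n IHn] A mA.
  rewrite big_ord0 /= diracE mem_set//; by case.
have mB : measurable [set v : 'rV[R]_n | forall i, A (lift ord0 i) (v ord0 i)].
  rewrite (_ : [set v | _] = \bigcap_(i in [set: 'I_n])
      ((fun v : 'rV[R]_n => v ord0 i) @^-1` A (lift ord0 i))).
    apply: fin_bigcap_measurable => // i _.
    by rewrite -[X in measurable X]setTI; exact: measurable_rV_coord.
  by apply/seteqP; split=> v /= h i; [move=> _|]; exact: h.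
rewrite big_ord_recl -IHn; last by move=> i.
rewrite -product_measure1E//=; last exact: mA.
rewrite /cons_measure /pushforward; congr product_measure1.
apply/seteqP; split=> -[x v] /=.
  move=> h; split; first by have := h ord0; rewrite mxE unlift_none.
  by move=> i; have := h (lift ord0 i); rewrite mxE liftK.
move=> [h0 h] i; rewrite mxE; case: unliftP => [j ->|->] //=; exact: h.
Qed.

End lebesgue_rV.

Section analysis_rV.
Variables (R : realType) (n : nat).
Local Notation pt := 'rV[R]_n.
Local Notation leb := (@lebesgue_rV R n).
Implicit Types (D : set pt) (f g : pt -> R).

(* Vector-, gradient- and tensor-valued functions are families of real-valued
   functions indexed by a finType; [enorm] is the Euclidean norm of the entries
   (the Frobenius norm for a tensor). *)
Definition enorm (I : finType) (v : I -> R) : R := Num.sqrt (\sum_i v i ^+ 2).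

(* The library's [ball] on row vectors is the ball of the sup norm. *)
Definition eball (x : pt) (r : R) : set pt :=
  [set y | enorm ((y - x) ord0) < r].

Definition eclosed_ball (x : pt) (r : R) : set pt :=
  [set y | enorm ((y - x) ord0) <= r].

Definition pderiv (a : 'I_n) f : pt -> R := fun x => 'D_(delta_mx ord0 a) f x.

Fixpoint Ck (k : nat) f : Prop :=
  match k with
  | 0 => continuous f
  | k'.+1 => forall a,
      (forall x, derivable f x (delta_mx ord0 a)) /\ Ck k' (pderiv a f)
  end.

Definition test_fun D f : Prop :=
  [/\ forall k, Ck k f,
      compact (closure [set x | f x != 0]) &
      closure [set x | f x != 0] `<=` D].

Definition in_Lp (p : \bar R) D f : Prop := (f \_ D) \in Lfun leb p.

Definition L2norm D f : \bar R := 'N[leb]_2%:E[EFin \o (f \_ D)].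

Definition weak_pderiv D (a : 'I_n) f g : Prop :=
  forall phi, test_fun D phi ->
    \int[leb]_(x in D) (f x * pderiv a phi x) =
    - \int[leb]_(x in D) (g x * phi x).

(* [H1 D u Du]: u is in H^1(D; R^N) and Du (i, a) is the weak derivative of u^i
   in direction a (so Du is determined almost everywhere by u). *)
Definition H1 N D (u : 'I_N -> pt -> R) (Du : 'I_N * 'I_n -> pt -> R) : Prop :=
  [/\ forall i, in_Lp 2%:E D (u i),
      forall k, in_Lp 2%:E D (Du k) &
      forall i a, weak_pderiv D a (u i) (Du (i, a))].

Definition H10 N D (u : 'I_N -> pt -> R) (Du : 'I_N * 'I_n -> pt -> R) : Prop :=
  H1 D u Du /\
  exists phi : nat -> 'I_N -> pt -> R,
    [/\ forall m i, test_fun D (phi m i),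
        forall i, L2norm D (phi m i \- u i) @[m --> \oo] --> 0%E &
        forall i a,
          L2norm D (pderiv a (phi m i) \- Du (i, a)) @[m --> \oo] --> 0%E].

(* A (i, j, a, b) is the coefficient usually written A_ij^{ab}. *)
Definition coeffs N := ('I_N * 'I_N * 'I_n * 'I_n)%type -> pt -> R.

Definition weak_solution N D (A : coeffs N) (Du : 'I_N * 'I_n -> pt -> R) :=
  forall (i : 'I_N) phi, test_fun D phi ->
    \int[leb]_(x in D)
      (\sum_a \sum_b \sum_j A (i, j, a, b) x * Du (j, b) x * pderiv a phi x) = 0.

Definition avg D f : R := (fine (leb D))^-1 * \int[leb]_(x in D) f x.

(* [sup] is the real one, so this is meaningful for F bounded on eball 0 (2 + r). *)
Definition omega2 (I : finType) (F : I -> pt -> R) (r : R) : R :=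
  sup [set Num.sqrt (avg (eball x r)
        (fun y => enorm (fun k => F k y - avg (eball x r) (F k)) ^+ 2))
      | x in eball 0 2].

Definition mean_osc (I : finType) (F : I -> pt -> R) D : R :=
  avg D (fun y => enorm (fun k => F k y - avg D (F k))).

(* The balls are those contained in the domain. *)
Definition BMO (I : finType) D (F : I -> pt -> R) : Prop :=
  (forall x r k, 0 < r -> eball x r `<=` D ->
     leb.-integrable (eball x r) (EFin \o F k)) /\
  (exists M, forall x r, 0 < r -> eball x r `<=` D ->
     mean_osc F (eball x r) <= M).

Definition VMO (I : finType) D (F : I -> pt -> R) : Prop :=
  BMO D F /\
  forall e, 0 < e -> exists2 d, 0 < d &
    forall x r, 0 < r < d -> eball x r `<=` D -> mean_osc F (eball x r) <= e.

Definition in_C (I : finType) D (F : I -> pt -> R) : Prop :=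
  forall k, {within D, continuous (F k)}.

Definition ae_in_C (I : finType) D (F : I -> pt -> R) : Prop :=
  exists2 G : I -> pt -> R, in_C D G &
    {ae leb, forall x, D x -> forall k, F k x = G k x}.

End analysis_rV.

(* Main.v *)
Require Import Defs.
From mathcomp Require Import all_boot all_order all_algebra.
From mathcomp Require Import all_classical all_reals all_analysis.
From mathcomp Require Import measurable_realfun ess_sup_inf.
From mathcomp Require Import ring lra.

Set Implicit Arguments.
Unset Strict Implicit.
Unset Printing Implicit Defensive.

Import Order.TTheory GRing.Theory Num.Theory.
Import numFieldNormedType.Exports.

Local Open Scope classical_set_scope.
Local Open Scope ring_scope.

(** The construction lives in the plane of the first two coordinates [x], [y].
Put [s = x ^ 2 + y ^ 2], [L(s) = 1 + ln (1 + 1 / s)] and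
[g = 1 + c sin (ln L(s))] with a small amplitude [c], and set
[u = x g], [v = y g].  Since [s g'(s)] is at most [c / L(s)], both the gradient
of [u] and the rotated gradient [(v_y, - v_x)] equal [(g, 0)] up to errors of
order [c / L(s)].  The matrix field that is the identity outside its first
column, the latter being tuned so that the field sends [grad u] to
[(v_y, - v_x)], is therefore [Id + O(c / L(s))]: it is continuous, equal to the
identity where [s = 0], and uniformly elliptic ([coercive]).  Rotated gradients
are divergence free, so [u] is a solution ([flux_divergence_free]); every
component of the system is this same scalar [u].

The function [g] is bounded and keeps oscillating as [s] tends to [0], so
[grad u] has no continuous representative ([Dgrad_discontinuous]).  It
oscillates as slowly as [ln ln (1 / s)], whose variation over a ball of radius
[r], once a thin strip of small relative volume is removed, is [O(1 / L(r))];
hence the mean oscillation tends to zero ([Dgrad_VMO]).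

The modulus of the coefficients is at most [kappa / L(t)] with [kappa]
proportional to [c] ([Acoef_omega]).  As [1 / (t L(t))] is essentially the
derivative of [- ln L(t)], the exponential in the integral condition is at most
a power of [L(t)] whose exponent is proportional to [c] times the given constant.
The ellipticity constants [1 / 2] and [Lambda] are fixed before [c], so [c] may
be chosen to make this exponent at most [1 / 2]; the integrand is then bounded by
[kappa L(t) ^ (- 1 / 2) / t ^ 2], and the condition follows ([dini_limsup]).

Pointwise estimates all go through the class [slow] of functions that are
Lipschitz at the scale of the distance [rho] to the singular set.  That the
classical derivatives off the singular set, which has codimension two, are weak
derivatives comes from Fubini's theorem and integration by parts on lines
([weak_pderiv_lines]). *)

(** * Functions that are Lipschitz at the scale of the distance to the origin *)

Section slow.
Variable R : realType.
Implicit Types (P Q : R * R) (f g : R * R -> R) (M : R).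

Definition nsq P : R := P.1 ^+ 2 + P.2 ^+ 2.
Definition rho P : R := Num.sqrt (nsq P).
Definition dist1 P Q : R := `|P.1 - Q.1| + `|P.2 - Q.2|.

Lemma nsq_ge0 P : 0 <= nsq P.
Proof. by rewrite addr_ge0// sqr_ge0. Qed.

Lemma rho_ge0 P : 0 <= rho P.
Proof. exact: sqrtr_ge0. Qed.

Lemma rho_sqr P : rho P ^+ 2 = nsq P.
Proof. by rewrite sqr_sqrtr// nsq_ge0. Qed.

Lemma nsq_gt0 P : (0 < nsq P) = (0 < rho P).
Proof. by rewrite sqrtr_gt0. Qed.

Lemma norm_fst_le_rho P : `|P.1| <= rho P.
Proof. by rewrite -sqrtr_sqr ler_sqrt ?nsq_ge0// lerDl sqr_ge0. Qed.

Lemma norm_snd_le_rho P : `|P.2| <= rho P.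
Proof. by rewrite -sqrtr_sqr ler_sqrt ?nsq_ge0// lerDr sqr_ge0. Qed.

Lemma rho_le_norm P : rho P <= `|P.1| + `|P.2|.
Proof.
have -> : `|P.1| + `|P.2| = Num.sqrt ((`|P.1| + `|P.2|) ^+ 2).
  by rewrite sqrtr_sqr [RHS]ger0_norm// addr_ge0.
rewrite ler_sqrt ?sqr_ge0//.
rewrite /nsq -(real_normK (num_real P.1)) -(real_normK (num_real P.2)).
have := normr_ge0 P.1; have := normr_ge0 P.2; nra.
Qed.

Lemma dist1_ge0 P Q : 0 <= dist1 P Q.
Proof. by rewrite addr_ge0. Qed.

Lemma dist1C P Q : dist1 P Q = dist1 Q P.
Proof. by rewrite /dist1 distrC (distrC P.2). Qed.

(** Triangle inequality for [rho], proved by squaring (Cauchy-Schwarz in the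
    plane). *)
Lemma rho_lip P Q : `|rho P - rho Q| <= dist1 P Q.
Proof.
wlog PQ : P Q / rho P <= rho Q.
  move=> H; have [/H//|/ltW/H] := leP (rho P) (rho Q).
  by rewrite distrC dist1C.
rewrite ler0_norm ?subr_le0// opprB lerBlDl.
apply: le_trans (_ : rho P + rho (Q.1 - P.1, Q.2 - P.2) <= _); last first.
  by rewrite lerD2l dist1C (le_trans (rho_le_norm _)).
set D := (Q.1 - P.1, Q.2 - P.2).
have P0 := rho_ge0 P; have D0 := rho_ge0 D; have Q0 := rho_ge0 Q.
rewrite -(@ler_pXn2r _ 2%N)// ?nnegrE ?addr_ge0//.
have := rho_sqr P; have := rho_sqr D; have := rho_sqr Q.
rewrite /nsq /D /= => eQ eD eP.
have CS : P.1 * (Q.1 - P.1) + P.2 * (Q.2 - P.2) <= rho P * rho D.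
  have [|neg] := leP 0 (P.1 * (Q.1 - P.1) + P.2 * (Q.2 - P.2)); last first.
    by rewrite (le_trans (ltW neg))// mulr_ge0.
  move=> pos; rewrite -(@ler_pXn2r _ 2%N)// ?nnegrE ?mulr_ge0//.
  rewrite exprMn eP eD.
  have := sqr_ge0 (P.1 * (Q.2 - P.2) - P.2 * (Q.1 - P.1)).
  set a := P.1; set b := P.2; set x := Q.1 - a; set y := Q.2 - b.
  move=> h; rewrite -subr_ge0.
  by have -> : (a ^+ 2 + b ^+ 2) * (x ^+ 2 + y ^+ 2) - (a * x + b * y) ^+ 2 =
     (a * y - b * x) ^+ 2 by ring.
rewrite sqrrD eQ eP eD.
rewrite -mulr_natl.
nra.
Qed.

(** The two inequalities say that [f] is bounded and that its Lipschitz constant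
    away from the disc of radius [r] is [M / r].  Points with [rho P = 0] satisfy
    the second one trivially, which accommodates the junk value that divisions
    by [rho P] give there.  The class is stable under products and under inverses
    of functions bounded below. *)
Definition slow M f := (forall P, `|f P| <= M) /\
  (forall P Q, rho P <= rho Q -> rho P * `|f P - f Q| <= M * dist1 P Q).

Lemma slow_ge0 M f : slow M f -> 0 <= M.
Proof. by case=> h _; apply: le_trans (h (0, 0)). Qed.

Lemma slow_bound M f : slow M f -> forall P, `|f P| <= M.
Proof. by case. Qed.

Lemma slow_diff M f r P Q : slow M f -> r <= rho P -> r <= rho Q ->
  r * `|f P - f Q| <= M * dist1 P Q.
Proof.
move=> [_ h] rP rQ; have [PQ|/ltW QP] := leP (rho P) (rho Q).
  by apply: le_trans (h _ _ PQ); rewrite ler_wpM2r.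
by rewrite distrC dist1C; apply: le_trans (h _ _ QP); rewrite ler_wpM2r.
Qed.

Lemma slow_le M M' f : M <= M' -> slow M f -> slow M' f.
Proof.
move=> MM' [b h]; split=> [P|P Q PQ]; first exact: le_trans (b P) _.
by apply: le_trans (h _ _ PQ) _; rewrite ler_wpM2r// dist1_ge0.
Qed.

Lemma slow_cst (a : R) : slow `|a| (fun=> a).
Proof.
split=> // P Q _; rewrite subrr normr0 mulr0.
by rewrite mulr_ge0// dist1_ge0.
Qed.

Lemma slowD M M' f g : slow M f -> slow M' g -> slow (M + M') (fun P => f P + g P).
Proof.
move=> [bf hf] [bg hg]; split=> [P|P Q PQ].
  by rewrite (le_trans (ler_normD _ _))// lerD.
rewrite opprD addrACA mulrDl.
apply: le_trans (lerD (hf _ _ PQ) (hg _ _ PQ)).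
by rewrite -mulrDr ler_wpM2l ?rho_ge0// ler_normD.
Qed.

Lemma slowM M M' f g : slow M f -> slow M' g ->
  slow (2 * M * M') (fun P => f P * g P).
Proof.
move=> sf sg; have M0 := slow_ge0 sf; have M'0 := slow_ge0 sg.
move: sf sg => [bf hf] [bg hg]; split=> [P|P Q PQ].
  rewrite normrM (le_trans (ler_pM _ _ (bf P) (bg P)))// -mulrA.
  by rewrite ler_peMl ?mulr_ge0// ler1n.
have -> : f P * g P - f Q * g Q = (f P - f Q) * g P + f Q * (g P - g Q) by ring.
have := hf _ _ PQ; have := hg _ _ PQ; set d := dist1 P Q => h1 h2.
have d0 : 0 <= d by exact: dist1_ge0.
rewrite (@le_trans _ _ (rho P * (`|f P - f Q| * M' + M * `|g P - g Q|)))//.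
  rewrite ler_wpM2l ?rho_ge0// (le_trans (ler_normD _ _))// !normrM lerD//.
    by rewrite ler_wpM2l.
  by rewrite ler_wpM2r.
rewrite mulrDr [X in X + _]mulrA [X in _ + X]mulrCA.
have : rho P * `|f P - f Q| * M' <= M * d * M' by rewrite ler_wpM2r.
have : M * (rho P * `|g P - g Q|) <= M * (M' * d) by rewrite ler_wpM2l.
nra.
Qed.

Lemma slowZ M f (a : R) : slow M f -> slow (`|a| * M) (fun P => a * f P).
Proof.
move=> [bf hf]; split=> [P|P Q PQ]; first by rewrite normrM ler_wpM2l.
by rewrite -mulrBr normrM mulrCA -mulrA ler_wpM2l// hf.
Qed.

Lemma slowV M f : slow M f -> (forall P, 2^-1 <= f P) ->
  slow (2 + 4 * M) (fun P => (f P)^-1).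
Proof.
move=> sf fh; have M0 := slow_ge0 sf; move: sf => [_ hf].
have f0 P : 0 < f P by rewrite (lt_le_trans _ (fh P)).
have i0 P : 0 <= (f P)^-1 <= 2.
  rewrite invr_ge0 ltW//= -[leRHS]invrK lef_pV2// ?posrE// invr_gt0.
have i1 P : `|(f P)^-1| <= 2 by rewrite ger0_norm; have /andP[] := i0 P.
split=> [P|P Q PQ]; first by rewrite (le_trans (i1 P))// lerDl mulr_ge0.
have -> : (f P)^-1 - (f Q)^-1 = - (f P - f Q) * ((f P)^-1 * (f Q)^-1).
  by field; rewrite !gt_eqF.
rewrite normrM normrN mulrA.
have d0 := dist1_ge0 P Q.
apply: le_trans (_ : M * dist1 P Q * 4 <= _); last by nra.
apply: ler_pM; rewrite ?mulr_ge0 ?rho_ge0//; first exact: hf.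
by rewrite normrM (le_trans (ler_pM _ _ (i1 P) (i1 Q)))//; lra.
Qed.

(** By [rho_lip], radial increments are at most increments in the plane. *)
Lemma slow_radial M (h : R -> R) : 0 <= M -> (forall r, `|h r| <= M) ->
  (forall r s, 0 < r -> r <= s -> r * `|h r - h s| <= M * (s - r)) ->
  slow M (fun P => h (rho P)).
Proof.
move=> M0 bh hh; split=> // P Q PQ.
have [P0|] := ltP 0 (rho P); last first.
  move=> P0; have -> : rho P = 0 by apply/eqP; rewrite eq_le P0 rho_ge0.
  by rewrite mul0r mulr_ge0// dist1_ge0.
rewrite (le_trans (hh _ _ P0 PQ))// ler_wpM2l//.
by rewrite (le_trans _ (rho_lip P Q))// distrC ler_norm.
Qed.

Lemma norm_fst_rho P : `|P.1 / rho P| <= 1.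
Proof.
rewrite normrM normfV (ger0_norm (rho_ge0 P)).
have := rho_ge0 P; rewrite le_eqVlt => /predU1P[<-|P0].
  by rewrite invr0 mulr0.
by rewrite ler_pdivrMr// mul1r norm_fst_le_rho.
Qed.

Lemma slow_fst : slow 2 (fun P => P.1 / rho P).
Proof.
split=> [P|P Q PQ]; first by rewrite (le_trans (norm_fst_rho P))// ler1n.
have := rho_ge0 P; rewrite le_eqVlt => /predU1P[<-|P0].
  by rewrite mul0r mulr_ge0// dist1_ge0.
have Q0 : 0 < rho Q by rewrite (lt_le_trans P0).
rewrite -[X in X * _](ger0_norm (ltW P0)) -normrM.
have -> : rho P * (P.1 / rho P - Q.1 / rho Q) =
    (P.1 - Q.1) + (rho Q - rho P) * (Q.1 / rho Q).
  by field; rewrite !gt_eqF.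
rewrite (le_trans (ler_normD _ _))// normrM.
have h1 := norm_fst_rho Q; have h2 := rho_lip Q P.
have h3 : `|P.1 - Q.1| <= dist1 P Q by rewrite lerDl.
have : `|rho Q - rho P| * `|Q.1 / rho Q| <= dist1 P Q * 1.
  by rewrite ler_pM// dist1C.
by move: h3; lra.
Qed.

Lemma slow_swap M f : slow M f -> slow M (fun P => f (P.2, P.1)).
Proof.
move=> [bf hf].
have rs P : rho (P.2, P.1) = rho P by rewrite /rho /nsq addrC.
have ds P Q : dist1 (P.2, P.1) (Q.2, Q.1) = dist1 P Q by rewrite /dist1 addrC.
by split=> // P Q PQ; have := hf (P.2, P.1) (Q.2, Q.1); rewrite !rs ds; exact.
Qed.

Lemma slow_snd : slow 2 (fun P => P.2 / rho P).
Proof.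
have := slow_swap slow_fst; rewrite (_ : (fun P => _) = fun P => P.2 / rho P)//.
by apply/funext => P; rewrite /rho /nsq addrC.
Qed.

End slow.

(** * The profile, the gradients and the coefficients in the plane *)

Section profile.
Variable R : realType.
Implicit Types (P Q : R * R) (c s : R).

(** Behaves like [ln (1 / s)] near [0] while staying at least [1] on the whole
    half-line, so it can be divided by everywhere. *)
Definition slog s : R := 1 + ln (1 + s^-1).

Lemma slog_ge1 s : 0 <= s -> 1 <= slog s.
Proof. by move=> s0; rewrite lerDl ln_ge0// lerDl invr_ge0. Qed.

Lemma slog_gt0 s : 0 <= s -> 0 < slog s.
Proof. by move=> /slog_ge1; apply: lt_le_trans. Qed.

Lemma slog_anti s t : 0 < s -> s <= t -> slog t <= slog s.
Proof.
move=> s0 st; have t0 := lt_le_trans s0 st.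
have D0 (u : R) : 0 < u -> 0 < 1 + u^-1 by move=> u0; rewrite addr_gt0 ?invr_gt0.
by rewrite lerD2l ler_ln ?posrE ?D0// lerD2l lef_pV2.
Qed.

(** The ratio of [1 + r ^ -2] and [1 + s ^ -2] is at most [(s / r) ^ 2], and
    [ln (s / r) <= s / r - 1]. *)
Lemma slog_lip (r s : R) : 0 < r -> r <= s ->
  slog (r ^+ 2) - slog (s ^+ 2) <= 2 * (s / r - 1).
Proof.
move=> r0 rs; have s0 := lt_le_trans r0 rs.
have r20 : 0 < r ^+ 2 by rewrite exprn_gt0.
have s20 : 0 < s ^+ 2 by rewrite exprn_gt0.
have ln_sr : ln (s / r) <= s / r - 1.
  have := @le_ln1Dx R (s / r - 1); rewrite addrCA subrr addr0; apply.
  by rewrite ltrBrDl subrr divr_gt0.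
rewrite /slog opprD addrACA subrr add0r lerBlDr.
apply: (@le_trans _ _ (ln (s / r) *+ 2 + ln (1 + (s ^+ 2)^-1))); last first.
  by rewrite lerD2r -[ln _ *+ 2]mulr_natl ler_wpM2l.
have D0 (u : R) : 0 < u -> 0 < 1 + u^-1 by move=> u0; rewrite addr_gt0 ?invr_gt0.
have q0 : 0 < (s / r) ^+ 2 by rewrite exprn_gt0// divr_gt0.
have Ds := D0 _ s20; have Dr := D0 _ r20.
have qD := mulr_gt0 q0 Ds.
rewrite -lnXn ?divr_gt0// -lnM ?posrE//.
rewrite ler_ln ?posrE//.
have -> : (s / r) ^+ 2 * (1 + (s ^+ 2)^-1) = s ^+ 2 / r ^+ 2 + (r ^+ 2)^-1.
  by field; rewrite !gt_eqF.
by rewrite lerD2r ler_pdivlMr// mul1r ler_pXn2r// ?nnegrE ltW.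
Qed.

Lemma ln_lip (m a b : R) : 0 < m -> m <= a -> m <= b ->
  `|ln a - ln b| <= `|a - b| / m.
Proof.
move=> m0; wlog ba : a b / b <= a.
  move=> H ma mb; have [ba|/ltW ab] := leP b a; first exact: H.
  by rewrite distrC (distrC a); apply: H.
move=> ma mb; have a0 := lt_le_trans m0 ma; have b0 := lt_le_trans m0 mb.
rewrite !ger0_norm ?subr_ge0 ?ler_ln ?posrE// -ln_div ?posrE//.
have := @le_ln1Dx R (a / b - 1); rewrite addrCA subrr addr0 => /(_ _)/le_trans -> //.
  by rewrite ltrBrDl subrr divr_gt0.
have -> : a / b - 1 = (a - b) / b by field; rewrite gt_eqF.
by rewrite ler_wpM2l ?subr_ge0// lef_pV2.
Qed.

Lemma norm_sinB (x y : R) : `|sin x - sin y| <= `|x - y|.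
Proof.
wlog yx : x y / y <= x.
  move=> H; have [/H//|/ltW/H] := leP y x.
  by rewrite distrC (distrC x).
have ds z : z \in `]y, x[ -> is_derive z 1 (@sin R) (cos z).
  by move=> _; exact: is_derive_sin.
have cs : {within `[y, x], continuous (@sin R)}.
  by apply: continuous_subspaceT => z; exact: continuous_sin.
have [z _ ->] := MVT_segment yx ds cs.
by rewrite normrM ler_piMl// cos_max.
Qed.

Lemma norm_cosB (x y : R) : `|cos x - cos y| <= `|x - y|.
Proof.
have := norm_sinB (x - pi / 2) (y - pi / 2).
by rewrite !sinBpihalf -opprD normrN opprB addrA subrK.
Qed.

(** The solution is [P.1 * profile], where [profile = 1 + c * sin phase]. *)
Definition phase P : R := ln (slog (nsq P)).

Lemma slog_rho P : slog (nsq P) = slog (rho P ^+ 2).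
Proof. by rewrite rho_sqr. Qed.

Lemma slow_phase_comp (h : R -> R) : (forall x, `|h x| <= 1) ->
  (forall x y, `|h x - h y| <= `|x - y|) -> slow 2 (fun P => h (phase P)).
Proof.
move=> h1 hl; rewrite (_ : (fun P => _) =
  (fun P => h (ln (slog (rho P ^+ 2))))); last first.
  by apply/funext => P; rewrite /phase slog_rho.
apply: (slow_radial (h := fun r => h (ln (slog (r ^+ 2))))) => //.
  by move=> r; rewrite (le_trans (h1 _))// ler1n.
move=> r s r0 rs; have s0 := lt_le_trans r0 rs.
apply: (@le_trans _ _ (r * (2 * (s / r - 1)))); last first.
  by rewrite le_eqVlt; apply/orP; left; apply/eqP; field; rewrite gt_eqF.
rewrite ler_pM2l// (le_trans (hl _ _))//.
rewrite (le_trans (@ln_lip 1 _ _ _ _ _))// ?slog_ge1 ?sqr_ge0//.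
rewrite divr1 ger0_norm ?slog_lip// subr_ge0 slog_anti ?exprn_gt0//.
by rewrite ler_pXn2r// nnegrE ltW.
Qed.

Lemma slow_slogV : slow 2 (fun P => (slog (nsq P))^-1).
Proof.
rewrite (_ : (fun P => _) = (fun P => (slog (rho P ^+ 2))^-1)); last first.
  by apply/funext => P; rewrite slog_rho.
apply: (slow_radial (h := fun r => (slog (r ^+ 2))^-1)) => // [r|r s r0 rs].
  have h := slog_ge1 (sqr_ge0 r).
  rewrite ger0_norm ?invr_ge0 ?(le_trans ler01)//.
  by rewrite (@le_trans _ _ 1) ?ler1n// invf_le1// (lt_le_trans _ h).
have s0 := lt_le_trans r0 rs.
apply: (@le_trans _ _ (r * (2 * (s / r - 1)))); last first.
  by rewrite le_eqVlt; apply/orP; left; apply/eqP; field; rewrite gt_eqF.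
rewrite ler_pM2l//; have := slog_lip r0 rs.
have := slog_ge1 (sqr_ge0 r); have := slog_ge1 (sqr_ge0 s).
have : slog (s ^+ 2) <= slog (r ^+ 2).
  by rewrite slog_anti ?exprn_gt0// ler_pXn2r// nnegrE ltW.
set a := slog (s ^+ 2); set b := slog (r ^+ 2) => ab acol1 b1; apply: le_trans.
have a0 := lt_le_trans ltr01 acol1; have b0 := lt_le_trans ltr01 b1.
rewrite ler0_norm ?subr_le0 ?lef_pV2// opprB.
have -> : a^-1 - b^-1 = (b - a) / (a * b) by field; rewrite !gt_eqF.
by rewrite ler_pdivrMr ?mulr_gt0// ler_peMr ?subr_ge0// mulr_ege1.
Qed.

Lemma slow_1DnsqV : slow 2 (fun P => (1 + nsq P)^-1).
Proof.
rewrite (_ : (fun P => _) = (fun P => (1 + rho P ^+ 2)^-1)); last first.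
  by apply/funext => P; rewrite rho_sqr.
have D0 (r : R) : 0 < 1 + r ^+ 2 by rewrite ltr_pwDl ?sqr_ge0.
apply: (slow_radial (h := fun r => (1 + r ^+ 2)^-1)) => // [r|r s r0 rs].
  rewrite ger0_norm ?invr_ge0 ?(ltW (D0 _))//.
  by rewrite (@le_trans _ _ 1) ?ler1n// invf_le1// lerDl sqr_ge0.
have s0 := lt_le_trans r0 rs.
have rs2 : r ^+ 2 <= s ^+ 2 by rewrite ler_pXn2r// nnegrE ltW.
rewrite ger0_norm; last by rewrite subr_ge0 lef_pV2 ?posrE// lerD2l.
have -> : r * ((1 + r ^+ 2)^-1 - (1 + s ^+ 2)^-1) =
    (r * (r + s)) * (s - r) / ((1 + r ^+ 2) * (1 + s ^+ 2)).
  by field; rewrite !gt_eqF.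
rewrite ler_pdivrMr ?mulr_gt0// [leRHS]mulrAC ler_wpM2r ?subr_ge0//.
have := sqr_ge0 (r - s); have : 0 <= r ^+ 2 * s ^+ 2 by rewrite mulr_ge0 ?sqr_ge0.
nra.
Qed.

(** [c * pslope P] is [s g'(s)] at [s = nsq P], where [g (nsq P)] is the profile;
    it is the quantity of order [c / slog s] behind all the error terms. *)
Definition pslope P : R := - cos (phase P) * ((1 + nsq P)^-1 * (slog (nsq P))^-1).
(** Products of the direction cosines, which are homogeneous of degree zero. *)
Definition dirxx P : R := (P.1 / rho P) * (P.1 / rho P).
Definition diryy P : R := (P.2 / rho P) * (P.2 / rho P).
Definition dirxy P : R := (P.1 / rho P) * (P.2 / rho P).

(** [dxu], [dyu] are the partial derivatives of [u = P.1 * g], and [dyu], [dyv]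
    those of [v = P.2 * g]: both mixed derivatives are [2 x y g'(s)]. *)
Definition dxu c P : R := 1 + c * (sin (phase P) + 2 * (dirxx P * pslope P)).
Definition dyu c P : R := c * (2 * (dirxy P * pslope P)).
Definition dyv c P : R := 1 + c * (sin (phase P) + 2 * (diryy P * pslope P)).
(** The first column of the coefficient matrix is [(1 + acol1, acol2)], the
    solution of [acol1E] and [acol2E]: with an identity second column, the matrix
    must send [(dxu, dyu)] to the rotated gradient [(dyv, - dyu)]. *)
Definition acol1 c P : R := c * ((2 * ((diryy P + -1 * dirxx P) * pslope P)) * (dxu c P)^-1).
Definition acol2 c P : R := c * ((- 4 * (dirxy P * pslope P)) * (dxu c P)^-1).

Lemma norm_snd_rho P : `|P.2 / rho P| <= 1.
Proof.
rewrite normrM normfV (ger0_norm (rho_ge0 P)).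
have := rho_ge0 P; rewrite le_eqVlt => /predU1P[<-|P0].
  by rewrite invr0 mulr0.
by rewrite ler_pdivrMr// mul1r norm_snd_le_rho.
Qed.

Lemma dirxx_01 P : 0 <= dirxx P <= 1.
Proof.
rewrite /dirxx -expr2 sqr_ge0/= -real_normK ?num_real//.
by rewrite exprn_ile1// norm_fst_rho.
Qed.

Lemma diryy_01 P : 0 <= diryy P <= 1.
Proof.
rewrite /diryy -expr2 sqr_ge0/= -real_normK ?num_real//.
by rewrite exprn_ile1// norm_snd_rho.
Qed.

Lemma norm_dirxy P : `|dirxy P| <= 1.
Proof.
by rewrite /dirxy normrM mulr_ile1 ?norm_fst_rho ?norm_snd_rho.
Qed.

Lemma norm_pslope_slog P : `|pslope P| <= (slog (nsq P))^-1.
Proof.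
have h := slog_ge1 (nsq_ge0 P); have i0 : 0 <= (slog (nsq P))^-1.
  by rewrite invr_ge0 (le_trans ler01).
rewrite /pslope normrM normrN mulrC normrM (ger0_norm i0) mulrAC.
rewrite ler_piMl// mulr_ile1// ?cos_max//.
have D1 : 1 <= 1 + nsq P by rewrite lerDl nsq_ge0.
have D0 := lt_le_trans ltr01 D1.
by rewrite normfV (gtr0_norm D0) invf_le1.
Qed.

Lemma norm_pslope P : `|pslope P| <= 1.
Proof.
rewrite (le_trans (norm_pslope_slog P))// invf_le1 ?slog_ge1 ?nsq_ge0//.
by rewrite slog_gt0// nsq_ge0.
Qed.

Lemma dxu_bounds c P : 0 <= c <= 16^-1 -> 2^-1 <= dxu c P <= 2.
Proof.
move=> /andP[c0 c1]; have K1 := norm_pslope P; have /andP[t0 t1] := dirxx_01 P.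
have s1 := sin_max (phase P).
have : `|sin (phase P) + 2 * (dirxx P * pslope P)| <= 3.
  rewrite (le_trans (ler_normD _ _))// (normrM 2) (normrM (dirxx P)) (@ger0_norm _ 2)//.
  rewrite (ger0_norm t0); have : dirxx P * `|pslope P| <= 1 by rewrite mulr_ile1.
  by move: s1; lra.
by rewrite ler_norml /dxu => /andP[]; nra.
Qed.

Lemma dxu_gt0 c P : 0 <= c <= 16^-1 -> 0 < dxu c P.
Proof. by move=> /(dxu_bounds P)/andP[]; lra. Qed.

Lemma acol1E c P : 0 <= c <= 16^-1 -> (1 + acol1 c P) * dxu c P = dyv c P.
Proof.
move=> cc; rewrite mulrDl mul1r {1}/acol1; move: (dxu_gt0 P cc) => /gt_eqF/negbT p0.
have mulK (x y z : R) : y != 0 -> z * (x * y^-1) * y = z * x.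
  by move=> y0; rewrite -!mulrA mulVf// mulr1.
by rewrite mulK// /dxu /dyv; ring.
Qed.

Lemma acol2E c P : 0 <= c <= 16^-1 -> acol2 c P * dxu c P + dyu c P = - dyu c P.
Proof.
move=> cc; rewrite /acol2; move: (dxu_gt0 P cc) => /gt_eqF/negbT p0.
have mulK (x y z : R) : y != 0 -> z * (x * y^-1) * y = z * x.
  by move=> y0; rewrite -!mulrA mulVf// mulr1.
by rewrite mulK// /dyu; ring.
Qed.

Lemma slow_dirxx : slow 8 dirxx.
Proof. by apply: slow_le (slowM (slow_fst R) (slow_fst R)); lra. Qed.

Lemma slow_diryy : slow 8 diryy.
Proof. by apply: slow_le (slowM (slow_snd R) (slow_snd R)); lra. Qed.

Lemma slow_dirxy : slow 8 dirxy.
Proof. by apply: slow_le (slowM (slow_fst R) (slow_snd R)); lra. Qed.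

Lemma slow_sin : slow 2 (fun P => sin (phase P)).
Proof. by apply: slow_phase_comp; [exact: sin_max|exact: norm_sinB]. Qed.

Lemma slow_pslope : slow 32 pslope.
Proof.
have sc : slow 2 (fun P => - cos (phase P)).
  apply: (slow_phase_comp (h := fun x => - cos x)) => x.
    by rewrite normrN cos_max.
  by move=> y; rewrite -opprD normrN norm_cosB.
apply: slow_le (slowM sc (slowM slow_1DnsqV slow_slogV)).
by lra.
Qed.

Lemma slow_dxu c : 0 <= c <= 16^-1 -> slow 66 (dxu c).
Proof.
move=> /andP[c0 c1].
have := slowD (slow_cst 1) (slowZ c (slowD slow_sin (slowZ 2 (slowM slow_dirxx slow_pslope)))).
apply: slow_le; rewrite normr1 !ger0_norm//; nra.
Qed.

Lemma slow_dyu c : 0 <= c <= 16^-1 -> slow 66 (dyu c).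
Proof.
move=> /andP[c0 c1]; have := slowZ c (slowZ 2 (slowM slow_dirxy slow_pslope)).
apply: slow_le; rewrite !ger0_norm//; nra.
Qed.

(** The value that the product and inverse rules give for [acol1 / c] and
    [acol2 / c]: the constants of [acol1], [acol2] are proportional to [c]. *)
Definition slow_const : R := 2 * 2048 * 266.

Lemma slow_const_ge0 : 0 <= slow_const.
Proof.
by apply: mulr_ge0; [apply: mulr_ge0; exact: ler0n|exact: ler0n].
Qed.

Lemma slow_acol1 c : 0 <= c <= 16^-1 -> slow (c * slow_const) (acol1 c).
Proof.
move=> cc; have s1 := slowV (slow_dxu cc) (fun P => (andP (dxu_bounds P cc)).1).
have s2 := slowZ 2 (slowM (slowD slow_diryy (slowZ (-1) slow_dirxx)) slow_pslope).
have := slowZ c (slowM s2 s1).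
have /andP[c0 _] := cc.
by apply: slow_le; rewrite /slow_const (ger0_norm c0) ler_wpM2l// normrN1 ger0_norm//; lra.
Qed.

Lemma slow_acol2 c : 0 <= c <= 16^-1 -> slow (c * slow_const) (acol2 c).
Proof.
move=> cc; have s1 := slowV (slow_dxu cc) (fun P => (andP (dxu_bounds P cc)).1).
have := slowZ c (slowM (slowZ (- 4) (slowM slow_dirxy slow_pslope)) s1).
have /andP[c0 _] := cc.
by apply: slow_le; rewrite /slow_const (ger0_norm c0) ler_wpM2l// normrN ger0_norm//; lra.
Qed.

Lemma norm_pslope_le P s : 0 < nsq P -> nsq P <= s ->
  `|pslope P| <= (slog s)^-1.
Proof.
move=> P0 Ps; rewrite (le_trans (norm_pslope_slog P))// lef_pV2 ?posrE ?slog_gt0//.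
- exact: slog_anti.
- exact: ltW.
- by rewrite (le_trans (ltW P0)).
Qed.

Lemma nsq0_dir P : nsq P = 0 -> [/\ dirxx P = 0, diryy P = 0 & dirxy P = 0].
Proof.
move=> P0; have r0 : rho P = 0 by rewrite /rho P0 sqrtr0.
by rewrite /dirxx /diryy /dirxy r0 invr0 !mulr0.
Qed.

(** The bound is stated with any [s >= nsq P] so as to cover the origin, where
    [slog (nsq P)] has the junk value [1] but the direction cosines vanish. *)
Lemma norm_acol1 c P s : 0 <= c <= 16^-1 -> 0 < s -> nsq P <= s ->
  `|acol1 c P| <= c * 8 / slog s.
Proof.
move=> cc s0 Ps; have /andP[c0 _] := cc.
have i0 : 0 <= (slog s)^-1 by rewrite invr_ge0 ltW// slog_gt0// ltW.
have := nsq_ge0 P; rewrite le_eqVlt => /predU1P[/esym/nsq0_dir[t1 t2 _]|P0].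
  by rewrite /acol1 t1 t2 mulr0 addr0 !(mul0r,mulr0) normr0 mulr_ge0// mulr_ge0.
have K := norm_pslope_le P0 Ps; have /andP[p0 _] := dxu_bounds P cc.
have /andP[t0 t1] := dirxx_01 P; have /andP[u0 u1] := diryy_01 P.
have T : `|diryy P + -1 * dirxx P| <= 1 by rewrite ler_norml; lra.
have V : `|(dxu c P)^-1| <= 2.
  rewrite ger0_norm ?invr_ge0 ?(le_trans _ p0) ?invr_ge0//.
  by rewrite -[leRHS]invrK lef_pV2 ?posrE ?(lt_le_trans _ p0) ?invr_gt0.
rewrite /acol1 normrM (ger0_norm c0) -[leRHS]mulrA ler_wpM2l// normrM (normrM 2).
rewrite (normrM (_ + _)) (@ger0_norm _ 2)//.
have : `|diryy P + -1 * dirxx P| * `|pslope P| <= 1 * (slog s)^-1 by rewrite ler_pM.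
set x := _ * `|pslope P| => h.
have x0 : 0 <= x by rewrite mulr_ge0.
have : 2 * x * `|(dxu c P)^-1| <= (2 * x) * 2 by rewrite ler_wpM2l// mulr_ge0.
by move: h; lra.
Qed.

Lemma norm_acol2 c P s : 0 <= c <= 16^-1 -> 0 < s -> nsq P <= s ->
  `|acol2 c P| <= c * 8 / slog s.
Proof.
move=> cc s0 Ps; have /andP[c0 _] := cc.
have i0 : 0 <= (slog s)^-1 by rewrite invr_ge0 ltW// slog_gt0// ltW.
have := nsq_ge0 P; rewrite le_eqVlt => /predU1P[/esym/nsq0_dir[_ _ t]|P0].
  by rewrite /acol2 t !(mul0r,mulr0) normr0 mulr_ge0// mulr_ge0.
have K := norm_pslope_le P0 Ps; have /andP[p0 _] := dxu_bounds P cc.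
have T := norm_dirxy P.
have V : `|(dxu c P)^-1| <= 2.
  rewrite ger0_norm ?invr_ge0 ?(le_trans _ p0) ?invr_ge0//.
  by rewrite -[leRHS]invrK lef_pV2 ?posrE ?(lt_le_trans _ p0) ?invr_gt0.
rewrite /acol2 normrM (ger0_norm c0) -[leRHS]mulrA ler_wpM2l// normrM (normrM (- 4)).
rewrite (normrM (dirxy P)) normrN (@ger0_norm _ 4)//.
have : `|dirxy P| * `|pslope P| <= 1 * (slog s)^-1 by rewrite ler_pM.
set x := _ * `|pslope P| => h.
have x0 : 0 <= x by rewrite mulr_ge0.
have : 4 * x * `|(dxu c P)^-1| <= (4 * x) * 2 by rewrite ler_wpM2l// mulr_ge0.
by move: h; lra.
Qed.

End profile.

(** * Classical derivatives in the plane *)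

Section plane_derivatives.
Variable R : realType.
Implicit Types (P Q : R * R) (c s w t : R).

Definition slope s : R := - cos (ln (slog s)) * ((1 + s)^-1 * (slog s)^-1).

Lemma is_derive_chain (f g : R -> R) (x a b : R) :
  is_derive (g x) 1 f a -> is_derive x 1 g b ->
  is_derive x 1 (fun t => f (g t)) (a * b).
Proof. exact: is_derive1_comp. Qed.

Lemma is_derive_scale (f : R -> R) (k x d : R) :
  is_derive x 1 f d -> is_derive x 1 (fun t => k * f t) (k * d).
Proof. by move=> df; have [h1 h2] := is_deriveZ k df; apply: DeriveDef. Qed.

Lemma is_derive_addc (f : R -> R) (k x d : R) :
  is_derive x 1 f d -> is_derive x 1 (fun t => k + f t) d.
Proof.
move=> df; have [h1 h2] := is_deriveD (is_derive_cst k x 1) df.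
by apply: DeriveDef; [exact: h1|rewrite h2 add0r].
Qed.

Lemma is_derive_mul (f g : R -> R) (x a b : R) :
  is_derive x 1 f a -> is_derive x 1 g b ->
  is_derive x 1 (fun t => f t * g t) (f x * b + g x * a).
Proof. by move=> df dg; have [h1 h2] := is_deriveM df dg; apply: DeriveDef. Qed.

Definition dlnslog s : R := (slog s)^-1 * ((1 + s^-1)^-1 * - s ^- 2).

Lemma is_derive_lnslog s : 0 < s ->
  is_derive s 1 (fun s => ln (slog s)) (dlnslog s).
Proof.
move=> s0; have sn0 : s != 0 by rewrite gt_eqF.
have s10 : 0 < 1 + s^-1 by rewrite addr_gt0// invr_gt0.
have L0 : 0 < slog s by rewrite slog_gt0// ltW.
have d1 : is_derive s 1 (fun s => 1 + s^-1 : R) (- s ^- 2).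
  have [h1 h2] := is_deriveD (is_derive_cst (1 : R) s 1) (is_deriveV sn0 (is_derive_id s 1)).
  apply: DeriveDef; first exact: h1.
  by rewrite h2 add0r /GRing.scale/= mulr1.
have d2 : is_derive s 1 (fun s => ln (1 + s^-1)) ((1 + s^-1)^-1 * - s ^- 2).
  exact: (@is_derive_chain (@ln R) (fun s => 1 + s^-1) s _ _ (is_derive1_ln s10) d1).
have d3 : is_derive s 1 (@slog R) ((1 + s^-1)^-1 * - s ^- 2).
  have [h1 h2] := is_deriveD (is_derive_cst (1 : R) s 1) d2.
  by apply: DeriveDef; [exact: h1|rewrite h2 add0r].
exact: (@is_derive_chain (@ln R) (@slog R) s _ _ (is_derive1_ln L0) d3).
Qed.

(** [s] times this derivative is [slope s], and [slope (nsq P)] is [pslope P]. *)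
Lemma is_derive_profile s : 0 < s ->
  is_derive s 1 (fun s => sin (ln (slog s))) (slope s / s).
Proof.
move=> s0; have [h1 h2] := @is_derive_chain sin (fun s => ln (slog s)) s _ _
  (is_derive_sin (ln (slog s))) (is_derive_lnslog s0).
apply: DeriveDef; first exact: h1.
rewrite h2 /slope /dlnslog; field.
by rewrite (gt_eqF (slog_gt0 (ltW s0))) !gt_eqF// addr_gt0.
Qed.

Definition profile c P : R := 1 + c * sin (phase P).
Definition plane_u c P : R := P.1 * profile c P.
Definition swap P : R * R := (P.2, P.1).

Lemma nsq_swap P : nsq (swap P) = nsq P.
Proof. by rewrite /nsq addrC. Qed.

Lemma rho_swap P : rho (swap P) = rho P.
Proof. by rewrite /rho nsq_swap. Qed.

Lemma pslope_swap P : pslope (swap P) = pslope P.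
Proof. by rewrite /pslope /phase nsq_swap. Qed.

Lemma dxu_swap c P : dxu c (swap P) = dyv c P.
Proof. by rewrite /dxu /dyv pslope_swap /dirxx /diryy rho_swap /phase nsq_swap. Qed.

(** Exchanging the coordinates turns [u] into [v], hence transfers to [v] the
    derivatives computed for [u]. *)
Lemma dyu_swap c P : dyu c (swap P) = dyu c P.
Proof. by rewrite /dyu pslope_swap /dirxy rho_swap mulrC [X in _ = X]mulrC [_ / _ * _]mulrC. Qed.

Lemma is_derive_profile_line c w t : 0 < t ^+ 2 + w ->
  is_derive t 1 (fun t => 1 + c * sin (ln (slog (t ^+ 2 + w))))
    (c * (2 * t * (slope (t ^+ 2 + w) / (t ^+ 2 + w)))).
Proof.
move=> s0.
have d1 : is_derive t 1 (fun t => t ^+ 2 + w : R) (2 * t).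
  have [h1 h2] := is_derive_mul (is_derive_id t 1) (is_derive_id t 1).
  have [k1 k2] := is_derive_addc w (DeriveDef h1 h2).
  rewrite (_ : (fun t : R => t ^+ 2 + w) = (fun t => w + t * t)).
    by apply: DeriveDef; [exact: k1|rewrite k2; ring].
  by apply/funext => z; rewrite addrC expr2.
have d2 := @is_derive_chain (fun s => sin (ln (slog s))) (fun t => t ^+ 2 + w) t
  _ _ (is_derive_profile s0) d1.
have [h1 h2] := is_derive_addc 1 (is_derive_scale c d2).
by apply: DeriveDef; [exact: h1|rewrite h2; ring].
Qed.

Lemma dirxxE P : 0 < nsq P -> dirxx P = P.1 ^+ 2 / nsq P.
Proof.
move=> P0; rewrite -rho_sqr /dirxx; field.
by rewrite gt_eqF// -nsq_gt0.
Qed.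

Lemma dirxyE P : 0 < nsq P -> dirxy P = P.1 * P.2 / nsq P.
Proof.
move=> P0; rewrite -rho_sqr /dirxy; field.
by rewrite gt_eqF// -nsq_gt0.
Qed.

Lemma is_derive_plane_u_x c (X Y : R) : Y != 0 ->
  is_derive X 1 (fun X => plane_u c (X, Y)) (dxu c (X, Y)).
Proof.
move=> Y0; have Y20 : 0 < Y ^+ 2 by rewrite exprn_even_gt0.
have s0 : 0 < X ^+ 2 + Y ^+ 2 by rewrite ltr_wpDl// sqr_ge0.
have [h1 h2] := is_derive_mul (is_derive_id X 1) (is_derive_profile_line c s0).
apply: DeriveDef; first exact: h1.
rewrite h2 /dxu dirxxE// /pslope /phase /slope.
rewrite (_ : X ^+ 2 + Y ^+ 2 = nsq (X, Y))//; move: s0.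
rewrite -/(nsq (X, Y)) => s0; move: (nsq (X, Y)) s0 => s s0.
by rewrite /=; field; rewrite (gt_eqF (slog_gt0 (ltW s0))) !gt_eqF// addr_gt0.
Qed.

Lemma is_derive_plane_u_y c (X Y : R) : X != 0 ->
  is_derive Y 1 (fun Y => plane_u c (X, Y)) (dyu c (X, Y)).
Proof.
move=> X0; have X20 : 0 < X ^+ 2 by rewrite exprn_even_gt0.
have s0 : 0 < Y ^+ 2 + X ^+ 2 by rewrite ltr_wpDl// sqr_ge0.
have [h1 h2] := is_derive_scale X (is_derive_profile_line c s0).
have E : (fun Y => plane_u c (X, Y)) =
    (fun Y : R => X * (1 + c * sin (ln (slog (Y ^+ 2 + X ^+ 2))))).
  by apply/funext => y; rewrite /plane_u /profile /phase /nsq/= (addrC (X ^+ 2)).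
rewrite E; apply: DeriveDef; first exact: h1.
have s0' : 0 < nsq (X, Y) by rewrite /nsq/= addrC.
rewrite h2 /dyu dirxyE// /pslope /phase /slope.
rewrite (_ : Y ^+ 2 + X ^+ 2 = nsq (X, Y)); last by rewrite /nsq/= addrC.
move: (nsq (X, Y)) s0' => s {}s0.
by rewrite /=; field; rewrite (gt_eqF (slog_gt0 (ltW s0))) !gt_eqF// addr_gt0.
Qed.

End plane_derivatives.

(** * Oscillation estimates in the plane *)

Section oscillation.
Variables (R : realType) (c : R).
Hypothesis cc : 0 <= c <= 16^-1.
Implicit Types (P Q : R * R) (s t r e : R).

Let c0 : 0 <= c. Proof. by case/andP: cc. Qed.

(** [784 = 2 * 8 * 49] comes from pairs near the origin, [16 * slow_const] from
    pairs away from it; see [slow_log_osc]. *)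
Definition osc_const : R := 784 + 16 * slow_const R.

Lemma osc_const_ge0 : 0 <= osc_const.
Proof.
by apply: addr_ge0; [exact: ler0n|apply: mulr_ge0; [exact: ler0n|exact: slow_const_ge0]].
Qed.

Lemma slog_le_slog49 t : 0 < t -> slog t <= 49 * slog (49 * t).
Proof.
move=> t0; have t490 : 0 < 49 * t by rewrite mulr_gt0.
have D0 (u : R) : 0 < u -> 0 < 1 + u^-1 by move=> u0; rewrite addr_gt0 ?invr_gt0.
have l49 : ln (49 : R) <= 48.
  have := @le_ln1Dx R 48; rewrite (_ : 1 + 48 = 49); last by ring.
  by apply; rewrite (lt_trans (ltrN10 _)).
have lM : ln (1 + t^-1) <= ln 49 + ln (1 + (49 * t)^-1).
  rewrite -lnM ?posrE ?D0// ler_ln ?posrE ?mulr_gt0 ?D0//.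
  rewrite mulrDr mulr1 invfM mulrA divff// mul1r lerD2r.
  by rewrite ler1n.
have l0 : 0 <= ln (1 + (49 * t)^-1) by rewrite ln_ge0// lerDl invr_ge0 ltW.
rewrite /slog; lra.
Qed.

Lemma sqrt_slog t : 0 < t <= 2 -> Num.sqrt t * slog t <= 4.
Proof.
move=> /andP[t0 t2]; set u := Num.sqrt t.
have u0 : 0 < u by rewrite sqrtr_gt0.
have uu : u ^+ 2 = t by rewrite sqr_sqrtr// ltW.
have u2 : u <= 2.
  by rewrite -(@ler_pXn2r _ 2%N)// ?nnegrE ?(ltW u0)// uu (le_trans t2)//; lra.
have i0 : 0 < u^-1 by rewrite invr_gt0.
have l1 : ln (1 + u^-1) <= u^-1 by apply: le_ln1Dx; rewrite (lt_trans _ i0)// ltrN10.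
have l2 : ln (1 + t^-1) <= 2 * ln (1 + u^-1).
  rewrite mulr_natl -lnXn ?addr_gt0// ler_ln ?posrE ?exprn_gt0 ?addr_gt0 ?invr_gt0//.
  by rewrite -uu -exprVn; move: i0; nra.
have : u * slog t <= u * (1 + 2 * u^-1).
  by rewrite ler_pM2l// lerD2l (le_trans l2)// ler_wpM2l.
rewrite [u * (1 + 2 * u^-1)](_ : _ = u + 2); last by field; rewrite gt_eqF.
by move: u2; lra.
Qed.

Variables (f : R * R -> R).
Hypotheses (sf : slow (c * slow_const R) f).
Hypothesis fs : forall P s, 0 < s -> nsq P <= s -> `|f P| <= c * 8 / slog s.

(** A logarithmic modulus of continuity.  If one of the points has [nsq <= t],
    both have [nsq <= 49 t] and the smallness bound applies to each.  Otherwise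
    both are at distance at least [sqrt t] from the origin and the Lipschitz bound
    gives [O(sqrt t)], which is [O(1 / slog t)]. *)
Lemma slow_log_osc P Q t : 0 < t <= 2 -> dist1 P Q <= 4 * t ->
  `|f P - f Q| <= c * osc_const / slog t.
Proof.
wlog PQ : P Q / nsq P <= nsq Q.
  move=> H; have [/H//|/ltW/H h] := leP (nsq P) (nsq Q).
  by move=> tt d; rewrite distrC h// dist1C.
move=> /[dup] tt /andP[t0 t2] d.
have L0 := slog_gt0 (ltW t0); have M0 := slow_const_ge0 R.
set u := Num.sqrt t.
have u0 : 0 < u by rewrite sqrtr_gt0.
have uu : u ^+ 2 = t by rewrite sqr_sqrtr// ltW.
have rtu X : (nsq X <= t) = (rho X <= u).
  by rewrite -uu -rho_sqr ler_pXn2r ?nnegrE ?rho_ge0 ?(ltW u0).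
rewrite ler_pdivlMr//.
have [Pt|tP] := leP (nsq P) t.
  have t490 : 0 < 49 * t by rewrite mulr_gt0.
  have Q49 : nsq Q <= 49 * t.
    have : rho Q <= u + 4 * t.
      have := rho_lip Q P; rewrite ler_norml => /andP[_]; rewrite dist1C.
      by move: Pt d; rewrite rtu; lra.
    have u2 : u <= 3 / 2.
      by rewrite -(@ler_pXn2r _ 2%N)// ?nnegrE ?(ltW u0)// uu; nra.
    move=> h; have {}h : rho Q <= 7 * u by rewrite (le_trans h)// -uu; nra.
    rewrite -rho_sqr -uu (_ : 49 * u ^+ 2 = (7 * u) ^+ 2); last by ring.
    by rewrite ler_pXn2r ?nnegrE ?rho_ge0 ?mulr_ge0 ?(ltW u0).
  have P49 : nsq P <= 49 * t by rewrite (le_trans Pt)// ler_peMl ?ler1n// ltW.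
  have L490 := slog_gt0 (ltW t490).
  have h : `|f P - f Q| <= c * 16 / slog (49 * t).
    rewrite (le_trans (ler_normB _ _))//.
    rewrite (_ : c * 16 / slog (49 * t) = c * 8 / slog (49 * t) + c * 8 / slog (49 * t)).
      by rewrite lerD// fs.
    by field; rewrite gt_eqF.
  have := slog_le_slog49 t0; set L' := slog (49 * t) in h L490 *; set L := slog t in L0 *.
  move=> LL; have : `|f P - f Q| * L <= (c * 16 / L') * (49 * L').
    by rewrite ler_pM ?(ltW L0).
  move/le_trans; apply; rewrite (_ : _ * (49 * L') = c * 784); last first.
    by field; rewrite gt_eqF.
  by rewrite ler_wpM2l// /osc_const lerDl mulr_ge0.
have uP : u <= rho P by rewrite leNgt; apply/negP => /ltW; rewrite -rtu leNgt tP.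
have uQ : u <= rho Q.
  rewrite leNgt; apply/negP => /ltW; rewrite -rtu leNgt.
  by rewrite (lt_le_trans tP PQ).
have h := slow_diff sf uP uQ.
have cM0 : 0 <= c * slow_const R by rewrite mulr_ge0.
have h2 : u * `|f P - f Q| <= u * (c * slow_const R * (4 * u)).
  rewrite (le_trans h)// [leRHS]mulrCA ler_wpM2l// (le_trans d)// -uu.
  by rewrite le_eqVlt; apply/orP; left; apply/eqP; ring.
rewrite ler_pM2l// in h2.
have : `|f P - f Q| * slog t <= (c * slow_const R * (4 * u)) * slog t.
  by rewrite ler_wpM2r// ltW.
move/le_trans; apply.
rewrite (_ : _ * slog t = (c * slow_const R * 4) * (u * slog t)); last by ring.
apply: (@le_trans _ _ (c * slow_const R * 4 * 4)).
  by rewrite ler_wpM2l ?sqrt_slog// mulr_ge0.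
by rewrite /osc_const; move: c0; nra.
Qed.

End oscillation.

Section gradient_oscillation.
Variables (R : realType) (c : R).
Hypothesis cc : 0 <= c <= 16^-1.
Implicit Types (P Q : R * R) (s t r e : R).

Let c0 : 0 <= c. Proof. by case/andP: cc. Qed.

Lemma slog_nsq_lip P Q r : 0 < r -> r <= rho P -> r <= rho Q ->
  r * `|slog (nsq P) - slog (nsq Q)| <= 2 * dist1 P Q.
Proof.
wlog PQ : P Q / rho P <= rho Q.
  move=> H; have [/H//|/ltW/H h] := leP (rho P) (rho Q).
  by move=> r0 rP rQ; rewrite distrC dist1C; exact: h.
move=> r0 rP _; have P0 := lt_le_trans r0 rP; have Q0 := lt_le_trans P0 PQ.
rewrite ger0_norm; last first.
  rewrite subr_ge0 slog_anti ?nsq_gt0// -!rho_sqr.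
  by rewrite ler_pXn2r ?nnegrE ?rho_ge0.
have := slog_lip P0 PQ; rewrite !rho_sqr; set D := _ - _ => h.
have D0 : 0 <= D.
  rewrite subr_ge0 slog_anti ?nsq_gt0// -!rho_sqr.
  by rewrite ler_pXn2r ?nnegrE ?rho_ge0.
apply: (@le_trans _ _ (rho P * (2 * (rho Q / rho P - 1)))).
  by rewrite ler_pM// ltW.
rewrite (_ : _ * _ = 2 * (rho Q - rho P)); last by field; rewrite gt_eqF.
by rewrite ler_wpM2l// dist1C (le_trans _ (rho_lip Q P))// ler_norm.
Qed.

Lemma phase_osc P Q r s : 0 < r -> r <= rho P -> r <= rho Q ->
  0 < s -> nsq P <= s -> nsq Q <= s ->
  `|phase P - phase Q| <= 2 * dist1 P Q / r / slog s.
Proof.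
move=> r0 rP rQ s0 Ps Qs; have L0 := slog_gt0 (ltW s0).
have P0 := lt_le_trans r0 rP; have Q0 := lt_le_trans r0 rQ.
have hP : slog s <= slog (nsq P) by rewrite slog_anti// nsq_gt0.
have hQ : slog s <= slog (nsq Q) by rewrite slog_anti// nsq_gt0.
apply: le_trans (ln_lip L0 hP hQ) _.
rewrite ler_wpM2r ?invr_ge0 ?(ltW L0)// ler_pdivlMr// mulrC.
exact: slog_nsq_lip.
Qed.

Lemma dir_pslope_small (T : R * R -> R) P s : (forall P, `|T P| <= 1) -> 0 < nsq P ->
  nsq P <= s -> `|2 * (T P * pslope P)| <= 2 / slog s.
Proof.
move=> Tle1 P0 Ps; rewrite normrM (@ger0_norm _ 2)// ler_wpM2l//.
by rewrite normrM -[leRHS]mul1r ler_pM// norm_pslope_le.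
Qed.

(** Outside the strip of width [e * r], points at mutual distance [O(r)] have
    comparable distances to the origin, so [slog] differs by [O(1 / e)] and its
    logarithm by [O(1 / e)] over the lower bound [slog s]. *)
Lemma grad_osc P Q r s e : 0 < e -> 0 < r -> e * r <= rho P -> e * r <= rho Q ->
  dist1 P Q <= 4 * r -> 0 < s -> nsq P <= s -> nsq Q <= s ->
  `|dxu c P - dxu c Q| <= (8 / e + 4) / slog s /\
  `|dyu c P - dyu c Q| <= (8 / e + 4) / slog s.
Proof.
move=> e0 r0 rP rQ d s0 Ps Qs; have L0 := slog_gt0 (ltW s0).
have er0 : 0 < e * r by rewrite mulr_gt0.
have P0 : 0 < nsq P by rewrite nsq_gt0 (lt_le_trans er0).
have Q0 : 0 < nsq Q by rewrite nsq_gt0 (lt_le_trans er0).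
have c1 : c <= 1 by case/andP: cc => _; lra.
have cle (X Y : R) : 0 <= Y -> `|X| <= Y -> `|c * X| <= Y.
  move=> Y0 XY; rewrite normrM (ger0_norm c0) -[leRHS]mul1r.
  by rewrite ler_pM.
have e80 : 0 <= 8 / e by rewrite divr_ge0// ltW.
have B0 : 0 <= (8 / e + 4) / slog s.
  by apply: divr_ge0; [exact: addr_ge0|exact: ltW].
have T1b X : `|dirxx X| <= 1 by have /andP[t0 t1] := dirxx_01 X; rewrite ger0_norm.
have split3 : (8 / e + 4) / slog s = 8 / e / slog s + (2 / slog s + 2 / slog s).
  by field; rewrite !gt_eqF.
split.
  have -> : dxu c P - dxu c Q = c * ((sin (phase P) - sin (phase Q)) +
     (2 * (dirxx P * pslope P) - 2 * (dirxx Q * pslope Q))) by rewrite /dxu; ring.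
  apply: cle => //; rewrite (le_trans (ler_normD _ _))// split3 lerD//; last first.
    by rewrite (le_trans (ler_normB _ _))// lerD// dir_pslope_small.
  rewrite (le_trans (norm_sinB _ _))// (le_trans (phase_osc er0 rP rQ s0 Ps Qs))//.
  rewrite ler_wpM2r ?invr_ge0 ?(ltW L0)// ler_pdivrMr// mulrA divfK ?gt_eqF//.
  by move: d; lra.
have -> : dyu c P - dyu c Q = c * (2 * (dirxy P * pslope P) - 2 * (dirxy Q * pslope Q)).
  by rewrite /dyu; ring.
apply: cle => //; rewrite (le_trans (ler_normB _ _))//.
rewrite (@le_trans _ _ (2 / slog s + 2 / slog s))//.
  by rewrite lerD// dir_pslope_small//; exact: norm_dirxy.
by rewrite split3 lerDr divr_ge0// ltW.
Qed.

End gradient_oscillation.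

(** * Lebesgue measure and topology of row vectors *)

Section rV_measure.
Variables (R : realType) (n : nat).
Local Notation pt := 'rV[R]_n.
Local Notation leb := (@lebesgue_rV R n).
Implicit Types (x y : pt) (r e : R).

Definition box x r : set pt :=
  [set y | forall i, `]x ord0 i - r, x ord0 i + r[%classic (y ord0 i)].

Lemma boxP x r y : box x r y <-> forall i, `|y ord0 i - x ord0 i| < r.
Proof.
split=> h i; have := h i; rewrite /= in_itv/= ltr_distl//.
Qed.

Lemma measurable_box x r : measurable (box x r).
Proof.
rewrite (_ : box x r = \bigcap_(i in [set: 'I_n])
    ((fun v : pt => v ord0 i) @^-1` `]x ord0 i - r, x ord0 i + r[%classic)).
  apply: fin_bigcap_measurable => // i _.
  by rewrite -[X in measurable X]setTI; exact: measurable_rV_coord.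
by apply/seteqP; split=> v h i; [move=> _|]; apply: h.
Qed.

Lemma leb_box x r : 0 <= r -> leb (box x r) = ((2 * r) ^+ n)%:E.
Proof.
move=> r0.
have := @lebesgue_rV_box R n (fun i => `]x ord0 i - r, x ord0 i + r[%classic).
move=> /(_ (fun i => measurable_itv _)); rewrite -/(box x r) => ->.
rewrite (eq_bigr (fun=> (2 * r)%:E)); last first.
  move=> i _; rewrite lebesgue_measure_itv/= lte_fin.
  case: ltP => h; last first.
    have -> : r = 0 by move: r0 h; lra.
    by rewrite mulr0.
  by rewrite -EFinD; congr EFin; ring.
by rewrite prodEFin prodr_const card_ord.
Qed.

Lemma ball_rVE x e : 0 < e -> ball x e = box x e.
Proof.
move=> e0; apply/seteqP; split=> y.
  by move=> [_ h]; apply/boxP => i; have := h ord0 i; rewrite /ball/= distrC.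
move=> /boxP h; split=> // i j; rewrite (ord1 i).
by have := h j; rewrite /ball/= distrC.
Qed.

(** The sigma-algebra generated by the coordinates is the Borel one: an open set
    is the union of the cubes with rational centre and radius [1 / k] that it
    contains. *)
Lemma open_measurable_rV (U : set pt) : open U -> measurable U.
Proof.
move=> oU; pose D (p : 'rV[rat]_n * nat) : set pt :=
  let b := box (map_mx ratr p.1) p.2.+1%:R^-1 in
  if `[< b `<=` U >] then b else set0.
have -> : U = \bigcup_p D p; last first.
  apply: countable_bigcupT_measurable => [|p]; first exact: countableP.
  by rewrite /D; case: asboolP => _; [exact: measurable_box|exact: measurable0].
apply/seteqP; split=> [x Ux|x [p _]]; last first.
  by rewrite /D; case: asboolP => // bU; exact: bU.
have /nbhs_ballP[e /= e0 xeU] : nbhs x U by exact: open_nbhs_nbhs.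
pose k := Num.truncn (2 / e).
have ke : k.+1%:R^-1 < e / 2.
  rewrite -[ltRHS]invrK ltf_pV2 ?posrE ?invr_gt0 ?divr_gt0// invf_div.
  by have := archimedean.Num.Theory.truncnS_gt (2 / e).
have k0 : 0 < k.+1%:R^-1 :> R by rewrite invr_gt0.
have qP i : {q : rat | `|ratr q - x ord0 i| < k.+1%:R^-1}.
  apply: cid; have /rat_in_itvoo[q] :
      x ord0 i - k.+1%:R^-1 < x ord0 i + k.+1%:R^-1.
    by rewrite ltrBlDr -addrA ltrDl addr_gt0.
  by rewrite in_itv/= => h; exists q; rewrite ltr_distl.
pose q : 'rV[rat]_n := \row_i sval (qP i).
have xq : box (map_mx ratr q) k.+1%:R^-1 x.
  by apply/boxP => i; rewrite !mxE distrC; exact: (svalP (qP i)).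
exists (q, k) => //; rewrite /D /=; case: asboolP => // bU; exfalso; apply: bU.
move=> y /boxP h; apply: xeU; rewrite ball_rVE//; apply/boxP => i.
have := h i; have /boxP/(_ i) := xq; rewrite distrC => h1 h2.
have -> : y ord0 i - x ord0 i = (y ord0 i - map_mx ratr q ord0 i) +
  (map_mx ratr q ord0 i - x ord0 i) by ring.
rewrite (le_lt_trans (ler_normD _ _))//.
by rewrite (lt_trans (ltrD h2 h1))// (splitr e) ltrD.
Qed.

Lemma continuous_measurable_rV (f : pt -> R) :
  continuous f -> measurable_fun [set: pt] f.
Proof.
move=> /continuousP cf; apply: (measurability _ (RGenOpens.measurableE R)).
move=> _ [_ [a [b ->] <-]]; rewrite setTI.
by apply: open_measurable_rV; apply: cf; exact: interval_open.
Qed.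

Lemma open_leb_gt0 (U : set pt) x : open U -> U x -> (0 < leb U)%E.
Proof.
move=> oU Ux; have /nbhs_ballP[e /= e0 xeU] : nbhs x U by exact: open_nbhs_nbhs.
apply: (@lt_le_trans _ _ (leb (box x e))).
  by rewrite leb_box 1?ltW// lte_fin exprn_gt0// mulr_gt0.
rewrite le_measure// ?inE; [exact: measurable_box|exact: open_measurable_rV|].
by rewrite -ball_rVE.
Qed.

Lemma leb_hyperplane0 (b : 'I_n) : leb [set x | x ord0 b = 0] = 0%E.
Proof.
pose A (i : 'I_n) : set R := if i == b then [set 0] else setT.
have mA i : measurable (A i) by rewrite /A; case: ifP => // _; exact: measurableT.
rewrite (_ : [set x | _] = [set v | forall i, A i (v ord0 i)]); last first.
  apply/seteqP; split=> x /=; last by move/(_ b); rewrite /A eqxx.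
  by move=> xb i; rewrite /A; case: eqP => // ->.
rewrite (lebesgue_rV_box mA) (bigD1 b)//= {1}/A eqxx.
by rewrite lebesgue_measure_set1 mul0e.
Qed.

Lemma measurable_hyperplane0 (b : 'I_n) : measurable [set x : pt | x ord0 b = 0].
Proof.
have := @measurable_rV_coord _ R n b measurableT [set 0] (measurable_set1 0).
by rewrite setTI.
Qed.

Lemma enorm_ge0 (I : finType) (v : I -> R) : 0 <= enorm v.
Proof. exact: sqrtr_ge0. Qed.

Lemma enorm_sqr (I : finType) (v : I -> R) : enorm v ^+ 2 = \sum_i v i ^+ 2.
Proof. by rewrite sqr_sqrtr// sumr_ge0// => i _; exact: sqr_ge0. Qed.

Lemma le_enorm (I : finType) (v : I -> R) i : `|v i| <= enorm v.
Proof.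
rewrite -sqrtr_sqr ler_sqrt; last by rewrite sumr_ge0// => j _; exact: sqr_ge0.
by rewrite (bigD1 i)//= lerDl sumr_ge0// => j _; exact: sqr_ge0.
Qed.

Lemma enorm_le (I : finType) (v : I -> R) M : 0 <= M -> (forall i, `|v i| <= M) ->
  enorm v <= #|I|%:R * M.
Proof.
move=> M0 h; rewrite -(@ler_pXn2r _ 2%N)// ?nnegrE ?enorm_ge0 ?mulr_ge0//.
rewrite enorm_sqr; apply: (@le_trans _ _ (\sum_(i : I) M ^+ 2)).
  apply: ler_sum => i _; rewrite -real_normK ?num_real//.
  by rewrite ler_pXn2r ?nnegrE.
rewrite sumr_const -[leLHS]mulr_natl exprMn ler_wpM2r ?sqr_ge0//.
by rewrite -natrX ler_nat; case: (#|I|) => [|k] //; rewrite -mulnn leq_pmulr.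
Qed.

Lemma eballP x r y i : eball x r y -> `|y ord0 i - x ord0 i| < r.
Proof. by move=> /(le_lt_trans (le_enorm _ i)); rewrite !mxE. Qed.

Lemma eball_sub_box x r : eball x r `<=` box x r.
Proof. by move=> y h; apply/boxP => i; exact: eballP h. Qed.

Lemma measurable_enorm d (T : measurableType d) (I : finType) (f : I -> T -> R) :
  (forall i, measurable_fun setT (f i)) ->
  measurable_fun setT (fun t => enorm (f ^~ t)).
Proof.
move=> mf; rewrite (_ : (fun t => _) = Num.sqrt \o (fun t => \sum_i f i t ^+ 2))//.
apply: measurableT_comp.
  by apply: continuous_measurable_fun; exact: sqrt_continuous.
by apply: measurable_sum => i; apply: measurable_funX.
Qed.

Lemma measurable_eball x r : measurable (eball x r).
Proof.
have mf : measurable_fun setT (fun y : pt => enorm ((y - x) ord0)).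
  apply: (measurable_enorm (f := fun i (y : pt) => (y - x) ord0 i)) => i.
  rewrite (_ : (fun y : pt => _) = (fun y : pt => y ord0 i - x ord0 i)).
    by apply: measurable_funB => //; exact: measurable_rV_coord.
  by apply/funext => y; rewrite !mxE.
have := mf measurableT _ (measurable_itv `]-oo, r[).
by rewrite setTI; congr measurable; apply/seteqP; split=> y /=; rewrite in_itv.
Qed.

Lemma leb_eball_lty x r : (leb (eball x r) < +oo)%E.
Proof.
have [r0|r0] := leP r 0.
  rewrite (_ : eball x r = set0) ?measure0//.
  apply/seteqP; split=> // y /= h.
  by have := le_lt_trans (enorm_ge0 _) h; rewrite ltNge r0.
apply: (@le_lt_trans _ _ (leb (box x r))); last by rewrite leb_box 1?ltW ?ltry.
apply: le_measure; rewrite ?inE; [exact: measurable_eball|exact: measurable_box|].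
exact: eball_sub_box.
Qed.

End rV_measure.

(** * Averages and oscillations over balls *)

Section averages.
Variables (R : realType) (n : nat).
Local Notation pt := 'rV[R]_n.
Local Notation leb := (@lebesgue_rV R n).
Implicit Types (x y z : pt) (r : R) (f g h : pt -> R).

Lemma box_sub_eball x r : 0 < r -> box x (r / n.+1%:R) `<=` eball x r.
Proof.
move=> r0 y /boxP h; rewrite /eball/=.
have d0 : 0 < r / n.+1%:R by rewrite divr_gt0.
apply: (@le_lt_trans _ _ (#|'I_n|%:R * (r / n.+1%:R))).
  by apply: enorm_le => [|i]; [exact: ltW|rewrite !mxE ltW].
by rewrite card_ord mulrCA gtr_pMr// ltr_pdivrMr// mul1r ltr_nat.
Qed.

Definition vol x r : R := fine (leb (eball x r)).

Lemma volE x r : leb (eball x r) = (vol x r)%:E.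
Proof. by rewrite /vol fineK// ge0_fin_numE// leb_eball_lty. Qed.

Lemma vol_ge x r : 0 < r -> (2 * (r / n.+1%:R)) ^+ n <= vol x r.
Proof.
move=> r0; have d0 : 0 < r / n.+1%:R by rewrite divr_gt0.
rewrite -lee_fin -volE -(leb_box x (ltW d0)) le_measure ?inE//.
- exact: measurable_box.
- exact: measurable_eball.
- exact: box_sub_eball.
Qed.

Lemma vol_gt0 x r : 0 < r -> 0 < vol x r.
Proof.
move=> r0; apply: lt_le_trans (vol_ge x r0).
by rewrite exprn_gt0// mulr_gt0// divr_gt0.
Qed.

(** Balls are comparable to cubes, so a thin strip occupies a small proportion
    of a ball. *)
Lemma strip_measure (i : 'I_n) x r (e : R) : 0 < r -> 0 < e ->
  (leb (eball x r `&` [set y | (`|y ord0 i| < e * r)%R]) <=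
    (e * n.+1%:R ^+ n * vol x r)%:E)%E.
Proof.
move=> r0 e0; have er0 : 0 < e * r by rewrite mulr_gt0.
pose A (j : 'I_n) : set R :=
  if j == i then `]- (e * r), e * r[%classic else `]x ord0 j - r, x ord0 j + r[%classic.
have mA j : measurable (A j) by rewrite /A; case: ifP.
have mB : measurable [set v : pt | forall j, A j (v ord0 j)].
  rewrite (_ : [set v | _] = \bigcap_(j in [set: 'I_n])
      ((fun v : pt => v ord0 j) @^-1` A j)).
    apply: fin_bigcap_measurable => // j _.
    by rewrite -[X in measurable X]setTI; exact: measurable_rV_coord.
  by apply/seteqP; split=> v h j; [move=> _|]; apply: h.
apply: (@le_trans _ _ (leb [set v : pt | forall j, A j (v ord0 j)])).
  apply: le_measure; rewrite ?inE//.
    apply: measurableI; first exact: measurable_eball.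
    have := @measurable_rV_coord _ R n i measurableT _
      (@measurable_itv R `]- (e * r), e * r[).
    rewrite setTI; congr measurable; apply/seteqP; split=> y /=;
      by rewrite in_itv/= ltr_norml.
  move=> y [Dy /= yi] j; rewrite /A; case: eqP => [->|_] /=; rewrite in_itv/=.
    by rewrite -ltr_norml.
  by rewrite -ltr_distl; exact: eballP Dy.
rewrite (lebesgue_rV_box mA) (bigD1 i)//= {1}/A eqxx.
rewrite (eq_bigr (fun=> (2 * r)%:E)); last first.
  move=> j /negbTE ji; rewrite /A ji lebesgue_measure_itv/= lte_fin.
  rewrite ifT; first by rewrite -EFinD; congr EFin; ring.
  by rewrite ltrBlDr -addrA ltrDl addr_gt0.
rewrite lebesgue_measure_itv/= lte_fin ifT; last by rewrite gtrN.
rewrite prodEFin prodr_const cardC1 card_ord -EFinD -EFinM lee_fin.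
have n0 : (0 < n)%N by exact: leq_ltn_trans (ltn_ord i).
have -> : (e * r - - (e * r)) * (2 * r) ^+ n.-1 = e * (2 * r) ^+ n.
  rewrite -[in RHS](prednK n0) exprS; ring.
rewrite -mulrA ler_wpM2l ?(ltW e0)//.
apply: (@le_trans _ _ (n.+1%:R ^+ n * (2 * (r / n.+1%:R)) ^+ n)); last first.
  by rewrite ler_wpM2l ?vol_ge// exprn_ge0.
rewrite -exprMn le_eqVlt; apply/orP; left; apply/eqP; congr (_ ^+ n).
by field.
Qed.

Lemma integrable_eball x r f (M : R) : measurable_fun setT f ->
  (forall y, eball x r y -> `|f y| <= M) ->
  leb.-integrable (eball x r) (EFin \o f).
Proof.
move=> mf fM; apply: measurable_bounded_integrable.
- exact: measurable_eball.
- exact: leb_eball_lty.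
- exact: measurable_funTS.
exists M; split; first exact: num_real.
by move=> N MN y Dy; apply: (le_trans (fM _ Dy)); exact: ltW.
Qed.

Lemma avg_cst x r (a : R) : 0 < r -> avg (eball x r) (fun=> a) = a.
Proof.
move=> r0; rewrite /avg Rintegral_cst; last exact: measurable_eball.
by rewrite mulrCA mulVf ?mulr1// gt_eqF// vol_gt0.
Qed.

Lemma avg_le x r f g : 0 < r ->
  leb.-integrable (eball x r) (EFin \o f) ->
  leb.-integrable (eball x r) (EFin \o g) ->
  (forall y, eball x r y -> f y <= g y) -> avg (eball x r) f <= avg (eball x r) g.
Proof.
move=> r0 fi gi fg; rewrite /avg ler_wpM2l//.
- by rewrite invr_ge0 ltW// vol_gt0.
by apply: le_Rintegral => //; exact: measurable_eball.
Qed.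

Lemma avg_dist x r f h (a : R) : 0 < r ->
  leb.-integrable (eball x r) (EFin \o f) ->
  leb.-integrable (eball x r) (EFin \o h) ->
  (forall y, eball x r y -> `|a - f y| <= h y) ->
  `|a - avg (eball x r) f| <= avg (eball x r) h.
Proof.
move=> r0 fi hi fh; have mD := measurable_eball x r.
have ci : leb.-integrable (eball x r) (EFin \o (fun=> a)).
  by apply: (@integrable_eball _ _ _ `|a|) => //; exact: measurable_cst.
have ai := integrableB mD ci fi.
have v0 : 0 <= (fine (leb (eball x r)))^-1.
  by rewrite invr_ge0 ltW// vol_gt0.
rewrite -{1}(avg_cst x a r0) /avg -mulrBr -RintegralB//.
rewrite normrM (ger0_norm v0) ler_wpM2l//.
apply: le_trans (le_normr_Rintegral mD ai) _.
by apply: le_Rintegral => //; exact: (integrable_norm ai).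
Qed.

Variable I : finType.
Implicit Types (F : I -> pt -> R).

(** The integrals defining [omega2] compare a function with its averages, hence
    are controlled by the oscillation over pairs of points of the ball. *)
Lemma omega2_bound F r (eta : R) : 0 < r -> 0 <= eta ->
  (forall k, measurable_fun setT (F k)) ->
  (forall k, exists M, forall y, `|F k y| <= M) ->
  (forall x y z, eball 0 2 x -> eball x r y -> eball x r z -> forall k,
    `|F k y - F k z| <= eta) ->
  0 <= omega2 F r <= #|I|%:R * eta.
Proof.
move=> r0 eta0 mF bF osc; rewrite /omega2; set S := [set _ | _ in _].
have Se s : S s -> 0 <= s <= #|I|%:R * eta.
  move=> [x x2 <-]; rewrite sqrtr_ge0/=.
  have K0 : 0 <= #|I|%:R * eta by rewrite mulr_ge0.
  rewrite -[leRHS](ger0_norm K0) -sqrtr_sqr ler_sqrt ?sqr_ge0//.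
  have iF k : leb.-integrable (eball x r) (EFin \o F k).
    by have [M FM] := bF k; apply: (integrable_eball (M := M)).
  have dist y : eball x r y ->
      enorm (fun k => F k y - avg (eball x r) (F k)) <= #|I|%:R * eta.
    move=> Dy; apply: enorm_le => // k.
    rewrite -[leRHS](avg_cst x _ r0); apply: avg_dist => //.
      by apply: (integrable_eball (M := `|eta|)) => //; exact: measurable_cst.
    by move=> z Dz; exact: (osc _ _ _ x2 Dy Dz).
  have sq y : eball x r y ->
      enorm (fun k => F k y - avg (eball x r) (F k)) ^+ 2 <= (#|I|%:R * eta) ^+ 2.
    by move=> Dy; rewrite ler_pXn2r ?nnegrE ?enorm_ge0// dist.
  rewrite -[leRHS](avg_cst x _ r0); apply: avg_le => //.
    apply: (integrable_eball (M := (#|I|%:R * eta) ^+ 2)).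
      apply: measurable_funX; apply: (measurable_enorm
        (f := fun k y => F k y - avg (eball x r) (F k))) => k.
      by apply: measurable_funB => //; exact: measurable_cst.
    by move=> y Dy; rewrite ger0_norm ?sqr_ge0// sq.
  by apply: (integrable_eball (M := `|(#|I|%:R * eta) ^+ 2|)) => //; exact: measurable_cst.
have S0 : S !=set0.
  exists (Num.sqrt (avg (eball 0 r)
    (fun y => enorm (fun k => F k y - avg (eball 0 r) (F k)) ^+ 2))).
  exists 0 => //; rewrite /eball/= subr0.
  apply: (@le_lt_trans _ _ (#|'I_n|%:R * 0)); last by rewrite mulr0.
  by apply: enorm_le => // i; rewrite mxE normr0.
have Sub : ubound S (#|I|%:R * eta) by move=> s /Se/andP[].
apply/andP; split; last by apply: ge_sup.
have [s Ss] := S0; have /andP[s0 _] := Se s Ss.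
by apply: (le_trans s0); apply: ub_le_sup => //; exists (#|I|%:R * eta).
Qed.

(** The relative volume of [S] is at most [e].  The distance to the average is at
    most [eta + 2 * M * e] off [S] and at most [2 * M] on it; averaging adds
    another [2 * M * e]. *)
Lemma mean_osc_bound F x r (S : set pt) (M eta e : R) : 0 < r -> 0 <= eta -> 0 <= M ->
  0 <= e -> measurable S -> (forall k, measurable_fun setT (F k)) ->
  (forall k y, `|F k y| <= M) ->
  (leb (eball x r `&` S) <= (e * vol x r)%:E)%E ->
  (forall y z, eball x r y -> eball x r z -> ~ S y -> ~ S z -> forall k,
    `|F k y - F k z| <= eta) ->
  mean_osc F (eball x r) <= #|I|%:R * (eta + 4 * M * e).
Proof.
move=> r0 eta0 M0 e0 mS mF FM SE osc.
have mD := measurable_eball x r; have v0 := vol_gt0 x r0.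
have iF k : leb.-integrable (eball x r) (EFin \o F k).
  exact: (integrable_eball (M := M)).
have mI (a b : R) : measurable_fun setT (fun y : pt => a + b * \1_S y).
  apply: measurable_funD; first exact: measurable_cst.
  by apply: measurable_funM; [exact: measurable_cst|exact: measurable_indic].
have indic01 y : 0 <= (\1_S y : R) <= 1.
  by rewrite indicE; case: (y \in S); rewrite ?lexx ?ler01.
have iI (a b : R) : leb.-integrable (eball x r) (EFin \o (fun y => a + b * \1_S y)).
  apply: (integrable_eball (M := `|a| + `|b|)) => // y _.
  rewrite (le_trans (ler_normD _ _))// lerD2l normrM ler_piMr//.
  by have /andP[i0 i1] := indic01 y; rewrite ger0_norm.
have avgI (a b : R) : 0 <= b -> avg (eball x r) (fun y => a + b * \1_S y) <= a + b * e.
  move=> b0; have i1 := iI 0 1; have ia := iI a 0.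
  have ic (d : R) : leb.-integrable (eball x r) (EFin \o (fun=> d)).
    by apply: (@integrable_eball _ _ _ `|d|) => //; exact: measurable_cst.
  have ii : leb.-integrable (eball x r) (EFin \o (\1_S : pt -> R)).
    apply: eq_integrable (iI 0 1) => // y _ /=.
    by rewrite add0r mul1r.
  have ib : leb.-integrable (eball x r) (EFin \o (fun y => b * \1_S y)).
    by apply: eq_integrable (iI 0 b) => // y _ /=; rewrite add0r.
  rewrite /avg (RintegralD mD (ic a) ib).
  rewrite mulrDr -/(avg (eball x r) (fun=> a)) avg_cst// lerD2l.
  rewrite RintegralZl// mulrCA ler_wpM2l// ler_pdivrMl//.
  rewrite /Rintegral integral_indic// setIC mulrC -lee_fin fineK//.
  rewrite ge0_fin_numE// (le_lt_trans _ (leb_eball_lty x r))//.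
  by apply: le_measure; rewrite ?inE//; exact: measurableI.
have dist k y : eball x r y ->
    `|F k y - avg (eball x r) (F k)| <= (eta + 2 * M * e) + 2 * M * \1_S y.
  move=> Dy; have M20 : 0 <= 2 * M by rewrite mulr_ge0.
  have FF z : `|F k y - F k z| <= 2 * M.
    by rewrite (le_trans (ler_normB _ _))// mulr_natl mulr2n lerD.
  have [Sy|nSy] := pselect (S y).
    rewrite indicE mem_set// mulr1.
    apply: (@le_trans _ _ (2 * M)); last by rewrite lerDr addr_ge0// mulr_ge0.
    rewrite -[leRHS](avg_cst x _ r0); apply: avg_dist => //.
    by apply: (@integrable_eball _ _ _ `|2 * M|) => //; exact: measurable_cst.
  rewrite indicE memNset// mulr0 addr0 (le_trans _ (avgI eta (2 * M) M20))//.
  apply: avg_dist => // z Dz; have [Sz|nSz] := pselect (S z).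
    by rewrite indicE mem_set// mulr1 (le_trans (FF z))// lerDr.
  by rewrite indicE memNset// mulr0 addr0 osc.
have dist' y : eball x r y -> enorm (fun k => F k y - avg (eball x r) (F k)) <=
    #|I|%:R * (eta + 2 * M * e) + #|I|%:R * (2 * M) * \1_S y.
  move=> Dy; rewrite -[X in _ + X]mulrA -mulrDr; apply: enorm_le => [|k]; last exact: dist.
  by have /andP[i0 _] := indic01 y; rewrite !addr_ge0// !mulr_ge0.
have -> : #|I|%:R * (eta + 4 * M * e) =
    #|I|%:R * (eta + 2 * M * e) + (#|I|%:R * (2 * M)) * e by ring.
apply: le_trans (avgI _ _ _); last by rewrite !mulr_ge0.
apply: avg_le => //.
apply: (integrable_eball
   (M := `|#|I|%:R * (eta + 2 * M * e)| + `|#|I|%:R * (2 * M)|)).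
  apply: (measurable_enorm (f := fun k y => F k y - avg (eball x r) (F k))) => k.
  by apply: measurable_funB => //; exact: measurable_cst.
move=> y Dy; rewrite ger0_norm ?enorm_ge0// (le_trans (dist' _ Dy))//.
rewrite lerD ?ler_norm// (le_trans (ler_norm _))// normrM ler_piMr//.
by have /andP[i0 i1] := indic01 y; rewrite ger0_norm.
Qed.

End averages.

(** * Integration over parallel lines *)

Section line_integrals.
Variable R : realType.

Lemma bounded_support_integrable d (T : measurableType d)
    (mu : {measure set T -> \bar R}) (B : set T) (h : T -> R) (M : R) :
  measurable B -> (mu B < +oo)%E -> measurable_fun setT h ->
  (forall x, `|h x| <= M) -> (forall x, h x != 0 -> B x) ->
  mu.-integrable setT (EFin \o h).
Proof.
move=> mB Boo mh hM hB.
have hBE : (EFin \o h) \_ B = EFin \o h.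
  apply/funext => x; rewrite patchE; case: ifPn => // /negP xB /=.
  by have [->//|/hB Bx] := eqVneq (h x) 0; exfalso; apply: xB; rewrite inE.
rewrite -hBE -integrable_mkcond//; apply: measurable_bounded_integrable => //.
  exact: measurable_funTS.
by exists M; split; [exact: num_real|move=> N MN x _; exact: le_trans (hM x) (ltW MN)].
Qed.

Lemma rV_cons0D n (t : R) (v : 'rV[R]_n) :
  rV_cons (t, v) = rV_cons (0, v) + t *: delta_mx ord0 ord0.
Proof.
apply/rowP => i; rewrite !mxE; case: unliftP => [j ->|->] /=.
  by rewrite mulr0 addr0.
by rewrite mulr1 add0r.
Qed.

Lemma rV_cons_liftD n (x t : R) (v : 'rV[R]_n) (a : 'I_n) :
  rV_cons (x, v + t *: delta_mx ord0 a) =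
  rV_cons (x, v) + t *: delta_mx ord0 (lift ord0 a).
Proof.
apply/rowP => i; rewrite !mxE; case: unliftP => [j ->|->] /=.
  by rewrite !mxE eqxx/= (inj_eq (@lift_inj _ _)).
by rewrite mulr0 addr0.
Qed.

(** Fubini's theorem along an arbitrary coordinate direction, by induction on the
    dimension: the measure is an iterated product, so the direction is either the
    first factor or a direction of the second one. Boundedness and bounded support
    are hypotheses that slices inherit. *)
Lemma integral_lines0 n (a : 'I_n) (h : 'rV[R]_n -> R) (K M : R) :
  0 <= K -> measurable_fun setT h ->
  (forall x, `|h x| <= M) -> (forall x, h x != 0 -> box 0 K x) ->
  (forall x, \int[lebesgue_measure]_t (h (x + t *: delta_mx ord0 a))%:E = 0)%E ->
  (\int[lebesgue_rV R n]_x (h x)%:E = 0)%E.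
Proof.
move=> K0; elim: n a h => [[]//|n IH] a h mh hM hK h0.
have mhc : measurable_fun setT (h \o @rV_cons R n).
  exact: measurableT_comp mh (@measurable_rV_cons R n).
have ihc : (@lebesgue_measure R \x lebesgue_rV R n)%E.-integrable setT
    (EFin \o (h \o @rV_cons R n)).
  pose P : set (measurableTypeR R * 'rV[R]_n) := @rV_cons R n @^-1` box 0 K.
  apply: (@bounded_support_integrable _ (measurableTypeR R * 'rV[R]_n)%type
    (lebesgue_measure \x lebesgue_rV R n)%E P _ M) => //.
  - rewrite -[X in measurable X]setTI; apply: measurable_rV_cons => //.
    exact: measurable_box.
  - have := leb_box (0 : 'rV[R]_n.+1) K0.
    by rewrite /= /cons_measure /pushforward => ->; rewrite ltry.
  - by move=> x; exact: hM.
  - by move=> x; exact: hK.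
have mhE : measurable_fun setT (EFin \o h) by exact/measurable_EFinP.
have E := @integral_pushforward _ _ (measurableTypeR R * 'rV[R]_n)%type 'rV[R]_n.+1
  R _ (@measurable_rV_cons R n) (lebesgue_measure \x lebesgue_rV R n)%E setT _
  mhE.
rewrite preimage_setT in E; refine (etrans (E ihc measurableT) _) => {E}.
case: (unliftP ord0 a) => [a' aE|aE].
  rewrite -integral12_prod_meas1//; apply: integral0_eq => x _.
  apply: (IH a' (fun v => h (rV_cons (x, v)))) => //.
  - exact: measurableT_comp mhc (measurable_pair1 x).
  - move=> v /hK/boxP hv; apply/boxP => i; have := hv (lift ord0 i).
    by rewrite !mxE liftK.
  - by move=> v; under eq_integral do rewrite rV_cons_liftD -aE; exact: h0.
rewrite -integral21_prod_meas1//; apply: integral0_eq => v _.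
rewrite /fubini_G/=.
by under eq_integral do rewrite rV_cons0D -aE; exact: h0.
Qed.

(** The hyperplane [x_b = 0] is negligible and is a union of lines of direction
    [a]; replacing [h] by zero on it reduces to [integral_lines0]. *)
Lemma integral_ae_lines0 n (a b : 'I_n) (h : 'rV[R]_n -> R) (K M : R) :
  a != b -> 0 <= K -> measurable_fun setT h ->
  (forall x, `|h x| <= M) -> (forall x, h x != 0 -> box 0 K x) ->
  (forall x : 'rV[R]_n, x ord0 b != 0 ->
    (\int[lebesgue_measure]_t (h (x + t *: delta_mx ord0 a))%:E = 0)%E) ->
  (\int[lebesgue_rV R n]_x (h x)%:E = 0)%E.
Proof.
move=> ab K0 mh hM hK h0; pose B : set 'rV[R]_n := [set x | x ord0 b = 0].
have mB : measurable B by exact: measurable_hyperplane0.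
pose k := h \_ (~` B).
have kE x : k x = if x ord0 b == 0 then 0 else h x.
  by rewrite /k patchE; case: eqP => xb; [rewrite memNset|rewrite mem_set] => //=.
rewrite -(@integral_lines0 n a k K M)//; last first.
- move=> x; have lineb t : (x + t *: delta_mx ord0 a) ord0 b = x ord0 b.
    by rewrite !mxE eqxx (negbTE (_ : b != a)) ?mulr0 ?addr0// eq_sym.
  have [xb|xb] := eqVneq (x ord0 b) 0.
    by apply: integral0_eq => t _; rewrite kE lineb xb eqxx.
  rewrite -[RHS](h0 x xb); apply: eq_integral => t _.
  by rewrite kE lineb (negbTE xb).
- by move=> x; rewrite kE; case: ifP => [_|_ /hK//]; rewrite eqxx.
- by move=> x; rewrite kE; case: ifP => // _; rewrite normr0 (le_trans _ (hM x)).
- apply: (measurable_restrict _ (measurableC mB) measurableT).1.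
  by rewrite setTI; exact: measurable_funTS.
apply: ae_eq_integral => //.
- exact/measurable_EFinP.
- apply/measurable_EFinP; apply: (measurable_restrict _ (measurableC mB) measurableT).1.
  by rewrite setTI; exact: measurable_funTS.
exists B; split=> //; first exact: leb_hyperplane0.
move=> x /= nh; apply: contrapT => /= Bx; apply: nh => _.
by rewrite kE; case: eqP.
Qed.

End line_integrals.

(** * Classical derivatives on lines are weak derivatives *)

Section test_functions.
Variables (R : realType) (n : nat).
Local Notation pt := 'rV[R]_n.
Local Notation leb := (@lebesgue_rV R n).
Implicit Types (D : set pt) (phi f g : pt -> R) (a b : 'I_n).

Lemma test_fun_continuous D phi : test_fun D phi -> continuous phi.
Proof. by case=> h _ _; exact: (h 0%N). Qed.

Lemma test_fun_measurable D phi : test_fun D phi -> measurable_fun setT phi.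
Proof. by move=> /test_fun_continuous; exact: continuous_measurable_rV. Qed.

Lemma test_fun_supp D phi x : test_fun D phi -> phi x != 0 -> D x.
Proof. by case=> _ _ h hx; apply: h; exact: subset_closure. Qed.

Lemma test_fun_bounded D phi : test_fun D phi -> exists M : R, forall x, `|phi x| <= M.
Proof.
move=> tp; have [_ cpt _] := tp.
have cts : {within closure [set x | phi x != 0], continuous phi}.
  exact/continuous_subspaceT/(test_fun_continuous tp).
have /compact_bounded[M [_ HM]] := continuous_compact cts cpt.
exists (`|M| + 1) => x; have [->|px] := eqVneq (phi x) 0.
  by rewrite normr0 addr_ge0.
apply: (HM (`|M| + 1)); first by rewrite ltr_pwDr// ler_norm.
by exists x => //; exact: subset_closure.
Qed.

Lemma pderiv_eq0 a phi x : ~ closure [set x | phi x != 0] x -> pderiv a phi x = 0.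
Proof.
move=> nx; have nbx : nbhs x (~` closure [set x | phi x != 0]).
  apply: open_nbhs_nbhs; split=> //; apply: closed_openC; exact: closed_closure.
transitivity ('D_(delta_mx ord0 a) (cst (0 : R) : pt -> R) x).
  2: exact: derive_cst.
apply: near_eq_derive.
near=> y; apply: contrapT => py.
have : (~` closure [set x | phi x != 0]) y by near: y.
by apply; apply: subset_closure; exact/eqP.
Unshelve. all: by end_near. Qed.

(** The support of a derivative lies in the closed support of the function. *)
Lemma test_fun_pderiv D a phi : test_fun D phi -> test_fun D (pderiv a phi).
Proof.
move=> [smooth cpt sub].
have csub : closure [set x | pderiv a phi x != 0] `<=`
    closure [set x | phi x != 0].
  rewrite [X in X `<=` _]closureE; apply: smallest_sub; first exact: closed_closure.
  move=> x /= px; apply: contrapT => /(@pderiv_eq0 a).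
  exact/eqP.
split; [by move=> k; have [] := smooth k.+1 a| |exact: subset_trans csub sub].
by apply: subclosed_compact cpt csub; exact: closed_closure.
Qed.

Lemma line_difference a f (x : pt) (t : R) : (fun h => h^-1 *:
    (((fun s => f (x + s *: delta_mx ord0 a)) \o shift t) (h *: 1) -
      f (x + t *: delta_mx ord0 a))) =
  (fun h => h^-1 *: ((f \o shift (x + t *: delta_mx ord0 a))
      (h *: delta_mx ord0 a) - f (x + t *: delta_mx ord0 a))).
Proof.
apply/funext => h /=; congr (_ *: (f _ - _)).
by rewrite [h%:A]mulr1 scalerDl addrCA.
Qed.

Lemma is_derive_line a f (x : pt) (t : R) :
  derivable f (x + t *: delta_mx ord0 a) (delta_mx ord0 a) ->
  is_derive t 1 (fun s => f (x + s *: delta_mx ord0 a))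
    (pderiv a f (x + t *: delta_mx ord0 a)).
Proof.
move=> df; apply: DeriveDef; first by rewrite /derivable line_difference.
by rewrite /pderiv /derive line_difference.
Qed.

Lemma test_fun_is_derive D a phi (x : pt) (t : R) : test_fun D phi ->
  is_derive t 1 (fun s => phi (x + s *: delta_mx ord0 a))
    (pderiv a phi (x + t *: delta_mx ord0 a)).
Proof. by move=> [/(_ 1%N)/= h _ _]; apply: is_derive_line; have [] := h a. Qed.

Lemma continuous_line a (x : pt) : continuous (fun t : R => x + t *: delta_mx ord0 a).
Proof.
move=> t; apply: cvgD; first exact: cvg_cst.
by apply: cvgZr_tmp; exact: cvg_id.
Qed.

(** On each line off the hyperplane [x_b = 0], [f * phi] is continuously
    differentiable and vanishes far away, so its derivative integrates to zero;
    [integral_ae_lines0] then integrates over the lines. *)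
Lemma weak_pderiv_lines D a b f g (K M : R) :
  a != b -> 0 <= M -> measurable D -> (leb D < +oo)%E -> D `<=` box 0 K ->
  measurable_fun setT f -> measurable_fun setT g ->
  (forall x, D x -> `|f x| <= M) -> (forall x, D x -> `|g x| <= M) ->
  (forall x : pt, x ord0 b != 0 ->
    continuous (fun t : R => g (x + t *: delta_mx ord0 a)) /\
    forall t : R, is_derive t 1 (fun s => f (x + s *: delta_mx ord0 a))
      (g (x + t *: delta_mx ord0 a))) ->
  weak_pderiv D a f g.
Proof.
move=> ab M0 mD Doo DK mf mg fM gM lineP phi tphi.
have tdphi := test_fun_pderiv a tphi.
have [M1 phiM] := test_fun_bounded tphi.
have [M2 dphiM] := test_fun_bounded tdphi.
have mphi := test_fun_measurable tphi; have mdphi := test_fun_measurable tdphi.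
have bnd (u v : pt -> R) Mu Mv : measurable_fun setT u -> measurable_fun setT v ->
    (forall x, D x -> `|u x| <= Mu) -> (forall x, `|v x| <= Mv) ->
    leb.-integrable D (EFin \o (fun x => u x * v x)).
  move=> mu mv uM vM; apply: measurable_bounded_integrable => //.
    by apply: measurable_funTS; exact: measurable_funM.
  exists (Mu * Mv); split; first exact: num_real.
  move=> N MN x Dx; apply: le_trans (ltW MN).
  by rewrite /= normrM ler_pM// uM.
apply/eqP; rewrite -addr_eq0 -RintegralD//; [|exact: bnd mf mdphi fM dphiM|exact: bnd mg mphi gM phiM].
pose h x := f x * pderiv a phi x + g x * phi x.
have hD x : h x != 0 -> D x.
  have [p0|/(test_fun_supp tphi)//] := eqVneq (phi x) 0.
  have [q0|/(test_fun_supp tdphi)//] := eqVneq (pderiv a phi x) 0.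
  by rewrite /h p0 q0 !mulr0 addr0 eqxx.
have mh : measurable_fun setT h.
  by apply: measurable_funD; exact: measurable_funM.
apply/eqP; rewrite Rintegral_mkcond [X in \int[_]_x X x](_ : _ = h); last first.
  apply/funext => x; rewrite patchE; case: ifPn => // /negP nD.
  by have [->//|/hD Dx] := eqVneq (h x) 0; exfalso; apply: nD; rewrite inE.
rewrite /Rintegral (@integral_ae_lines0 R n a b h `|K| (M * M2 + M * M1))//.
- move=> x; have [->|/hD Dx] := eqVneq (h x) 0; last first.
    rewrite (le_trans (ler_normD _ _))// !normrM lerD// ler_pM//; [exact: fM|exact: gM].
  have M10 := le_trans (normr_ge0 _) (phiM 0).
  have M20 := le_trans (normr_ge0 _) (dphiM 0).
  by rewrite normr0 addr_ge0// mulr_ge0.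
- move=> x /hD/DK/boxP xK; apply/boxP => i.
  by rewrite (lt_le_trans (xK i))// ler_norm.
move=> x /lineP[cg dg].
pose F t := f (x + t *: delta_mx ord0 a) * phi (x + t *: delta_mx ord0 a).
have dF (t : R) : is_derive t 1 F (h (x + t *: delta_mx ord0 a)).
  have [d1 d2] := is_deriveM (dg t) (@test_fun_is_derive D a phi x t tphi).
  by apply: DeriveDef; [exact: d1|rewrite d2 /h /GRing.scale/=; ring].
pose T := `|K| + `|x ord0 a| + 1.
have phi0 (t : R) : T <= `|t| -> phi (x + t *: delta_mx ord0 a) = 0.
  move=> Tt; have [//|/(test_fun_supp tphi)/DK/boxP/(_ a)] :=
    eqVneq (phi (x + t *: delta_mx ord0 a)) 0.
  rewrite !mxE !eqxx/= mulr1 subr0 => /lt_le_trans/(_ (ler_norm _)).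
  have := lerB_normD (t) (x ord0 a); rewrite addrC.
  by move: Tt; rewrite /T; lra.
have h0 (t : R) : T <= `|t| -> h (x + t *: delta_mx ord0 a) = 0.
  move=> Tt; rewrite /h phi0// mulr0 addr0.
  suff -> : pderiv a phi (x + t *: delta_mx ord0 a) = 0 by rewrite mulr0.
  have [//|/(test_fun_supp tdphi)/DK/boxP/(_ a)] :=
    eqVneq (pderiv a phi (x + t *: delta_mx ord0 a)) 0.
  rewrite !mxE !eqxx/= mulr1 subr0 => /lt_le_trans/(_ (ler_norm _)).
  have := lerB_normD (t) (x ord0 a); rewrite addrC.
  by move: Tt; rewrite /T; lra.
have T0 : 0 < T by rewrite /T ltr_pwDr// addr_ge0.
rewrite (_ : (fun t : R => (h (x + t *: delta_mx ord0 a))%:E) =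
    (fun t => (h (x + t *: delta_mx ord0 a))%:E) \_ `[- T, T]); last first.
  apply/funext => t; rewrite patchE; case: ifPn => // /negP; rewrite inE/= in_itv/=.
  by move=> /negP; rewrite -ler_norml -ltNge => /ltW/h0 ->.
rewrite -integral_mkcond.
have F0 : F T = 0 /\ F (- T) = 0.
  by rewrite /F !phi0 ?normrN ?ler_norm// !mulr0.
rewrite (@continuous_FTC2 _ (fun t => h (x + t *: delta_mx ord0 a)) F).
- by rewrite F0.1 F0.2 subee.
- by rewrite (lt_trans _ T0)// oppr_lt0.
- apply: continuous_subspaceT => t.
  have cc (u : pt -> R) : continuous u ->
      {for t, continuous (u \o (fun s : R => x + s *: delta_mx ord0 a))}.
    by move=> cu; apply: continuous_comp; [exact: continuous_line|exact: cu].
  apply: cvgD; apply: cvgM.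
  + apply: differentiable_continuous; apply/derivable1_diffP.
    exact: (ex_derive (is_derive := dg t)).
  + exact/cc/(test_fun_continuous tdphi).
  + exact: cg.
  + exact/cc/(test_fun_continuous tphi).
- have cF (t : R) : {for t, continuous F}.
    apply: differentiable_continuous; apply/derivable1_diffP.
    exact: (ex_derive (is_derive := dF t)).
  split.
  + by move=> t _; exact: (ex_derive (is_derive := dF t)).
  + exact/cvg_at_right_filter/cF.
  + exact/cvg_at_left_filter/cF.
- by move=> t _; rewrite derive1E; exact: (derive_val (is_derive := dF t)).
Qed.

End test_functions.

(** * Schwarz's theorem and rotated gradients *)

Section schwarz.
Variables (R : realType) (n : nat).
Local Notation pt := 'rV[R]_n.
Local Notation leb := (@lebesgue_rV R n).
Implicit Types (D : set pt) (phi v va vb : pt -> R) (a b : 'I_n) (x : pt).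
Local Notation e := (delta_mx ord0).

(** Mean value theorem in direction [a] for the increment in direction [b], then
    in direction [b] for the derivative in direction [a]. *)
Lemma second_difference D a b phi x (h : R) : test_fun D phi -> 0 < h ->
  exists xi eta : R, [/\ 0 <= xi <= h, 0 <= eta <= h &
    phi (x + h *: e a + h *: e b) - phi (x + h *: e a) -
      phi (x + h *: e b) + phi x =
    h * h * pderiv b (pderiv a phi) (x + xi *: e a + eta *: e b)].
Proof.
move=> tphi h0; have tdphi := test_fun_pderiv a tphi.
pose G (s : R) := phi (x + h *: e b + s *: e a) - phi (x + s *: e a).
pose dG (s : R) := pderiv a phi (x + h *: e b + s *: e a) -
  pderiv a phi (x + s *: e a).
have isG (s : R) : is_derive s 1 G (dG s).
  by apply: is_deriveB; exact: test_fun_is_derive tphi.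
have cG : {within `[0, h], continuous G}.
  apply: derivable_within_continuous => s _.
  exact: (ex_derive (is_derive := isG s)).
have [xi xih Gxi] := MVT_segment (ltW h0) (fun s _ => isG s) cG.
pose H (s : R) := pderiv a phi (x + xi *: e a + s *: e b).
pose dH (s : R) := pderiv b (pderiv a phi) (x + xi *: e a + s *: e b).
have isH (s : R) : is_derive s 1 H (dH s) by exact: test_fun_is_derive tdphi.
have cH : {within `[0, h], continuous H}.
  apply: derivable_within_continuous => s _.
  exact: (ex_derive (is_derive := isH s)).
have [eta etah Heta] := MVT_segment (ltW h0) (fun s _ => isH s) cH.
exists xi, eta; split.
- by move: xih; rewrite in_itv.
- by move: etah; rewrite in_itv.
have -> : phi (x + h *: e a + h *: e b) - phi (x + h *: e a) -
    phi (x + h *: e b) + phi x = G h - G 0.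
  by rewrite /G !scale0r !addr0 (addrAC x); ring.
rewrite Gxi subr0 /dG (addrAC x (h *: e b)).
rewrite subr0 /H scale0r addr0 in Heta.
by rewrite Heta /dH; ring.
Qed.

Lemma corner_box x (s t h r : R) i j : 0 <= s <= h -> 0 <= t <= h -> 2 * h < r ->
  box x r (x + s *: e i + t *: e j).
Proof.
move=> /andP[s0 sh] /andP[t0 th] hr; apply/boxP => k; rewrite !mxE eqxx/=.
have D0 (u : bool) : 0 <= (u%:R : R) <= 1 by case: u; rewrite ?ler01 ?lexx.
have cancel3 (p q w : R) : p + q + w - p = q + w.
  by rewrite addrC !addrA addNr add0r.
rewrite cancel3 (le_lt_trans (ler_normD _ _))//.
have /andP[v1 u1] := D0 (k == i); have /andP[v2 u2] := D0 (k == j).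
rewrite !ger0_norm ?mulr_ge0// (le_lt_trans _ hr)// mulrDl mul1r.
by rewrite lerD// (le_trans (ler_piMr _ _)).
Qed.

Lemma halves_contra (p q u : R) :
  `|p - u| < `|p - q| / 2 -> `|u - q| < `|p - q| / 2 -> False.
Proof.
move=> h1 h2; have := ltrD h1 h2; rewrite -splitr ltNge => /negP; apply.
exact: ler_distD.
Qed.

(** Schwarz's theorem, from the mean value theorem applied twice to the second
    difference, which is symmetric in the two directions. *)
Lemma pderivC D a b phi x : test_fun D phi ->
  pderiv a (pderiv b phi) x = pderiv b (pderiv a phi) x.
Proof.
move=> tphi; apply/eqP; rewrite -subr_eq0 -normr_eq0.
apply: contrapT => /negP ne0.
set d := `|_| in ne0; have d0 : 0 < d by rewrite lt_neqAle eq_sym ne0 normr_ge0.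
have cts i j : {for x, continuous (pderiv i (pderiv j phi))}.
  exact: (test_fun_continuous (test_fun_pderiv i (test_fun_pderiv j tphi))).
have near_pt i j : exists2 r : R, 0 < r & forall y, box x r y ->
    `|pderiv i (pderiv j phi) x - pderiv i (pderiv j phi) y| < d / 2.
  have d20 : 0 < d / 2 by rewrite divr_gt0.
  have /cvgrPdist_lt/(_ _ d20)/nbhs_ballP[r /= r0 hr] := cts i j.
  by exists r => // y; rewrite -ball_rVE//; exact: hr.
have [r1 r10 h1] := near_pt a b; have [r2 r20 h2] := near_pt b a.
have [h [h0 hr1 hr2]] : exists h : R, [/\ 0 < h, 2 * h < r1 & 2 * h < r2].
  exists (Num.min r1 r2 / 4).
  have : Num.min r1 r2 <= r2 by rewrite ge_min lexx orbT.
  have : Num.min r1 r2 <= r1 by rewrite ge_min lexx.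
  have : 0 < Num.min r1 r2 by rewrite lt_min r10.
  by clear; set m := Num.min _ _; move: m => m; split; lra.
have [xi [eta [xih etah E1]]] := second_difference b a x tphi h0.
have [xj [etb [xjh etbh E2]]] := second_difference a b x tphi h0.
have k1 := h1 _ (corner_box x b a xih etah hr1).
have k2 := h2 _ (corner_box x a b xjh etbh hr2).
have E : pderiv a (pderiv b phi) (x + xi *: e b + eta *: e a) =
    pderiv b (pderiv a phi) (x + xj *: e a + etb *: e b).
  apply: (@mulfI _ (h * h)); first by rewrite mulf_neq0// gt_eqF.
  rewrite (addrAC x (h *: e a) (h *: e b)) in E2.
  rewrite (addrAC (phi (x + h *: e b + h *: e a))) in E2.
  exact: etrans (esym E1) E2.
rewrite E in k1; rewrite distrC in k2.
exact: (halves_contra k1 k2).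
Qed.

(** Moving the derivatives to the test function turns the two terms into
    integrals of [v] against its two mixed second derivatives. *)
Lemma rotated_gradient_divergence_free D a b v va vb phi :
  weak_pderiv D a v va -> weak_pderiv D b v vb -> test_fun D phi ->
  measurable D ->
  leb.-integrable D (EFin \o (fun x => vb x * pderiv a phi x)) ->
  leb.-integrable D (EFin \o (fun x => va x * pderiv b phi x)) ->
  \int[leb]_(x in D) (vb x * pderiv a phi x - va x * pderiv b phi x) = 0.
Proof.
move=> wa wb tphi mD i1 i2; rewrite (RintegralB mD i1 i2).
have ea := wa _ (test_fun_pderiv b tphi).
have eb := wb _ (test_fun_pderiv a tphi).
have eab : \int[leb]_(x in D) (v x * pderiv b (pderiv a phi) x) =
    \int[leb]_(x in D) (v x * pderiv a (pderiv b phi) x).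
  by apply: eq_Rintegral => x _; rewrite (pderivC a b x tphi).
have aux (A B p q : R) : A = - p -> B = - q -> B = A -> q - p = 0.
  by move=> -> -> /oppr_inj ->; rewrite subrr.
exact: (aux _ _ _ _ ea eb eab).
Qed.

End schwarz.

(** * The solution on the ball of radius 4 *)

Section slow_rV.
Variables (R : realType) (m : nat).
Local Notation pt := 'rV[R]_m.+2.
Local Notation leb := (@lebesgue_rV R m.+2).
Implicit Types (x y : pt) (c M : R) (f : R * R -> R).

Definition axis1 : 'I_m.+2 := ord0.
Definition axis2 : 'I_m.+2 := lift ord0 ord0.
Definition proj x : R * R := (x ord0 axis1, x ord0 axis2).

Lemma slow_continuous M f x : slow M f -> 0 < rho (proj x) ->
  {for x, continuous (f \o proj)}.
Proof.
move=> sf r0; have M0 := slow_ge0 sf.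
apply/(@cvgrPdist_lt _ _ _ (nbhs x)) => e e0; apply/nbhs_ballP.
move: r0; set r := rho _ => r0.
(* The first bound on [d] keeps [y] at distance [r / 2] from the singular set;
   the second makes the resulting increment [4 * M * d / r] less than [e]. *)
pose d := Num.min (r / 4) (e * r / (8 * (M + 1))).
have M10 : 0 < 8 * (M + 1) by rewrite mulr_gt0// ltr_wpDl.
have d0 : 0 < d by rewrite lt_min !divr_gt0// mulr_gt0.
exists d => // y; rewrite ball_rVE// => /boxP yd.
have dist : dist1 (proj x) (proj y) <= 2 * d.
  have -> : 2 * d = d + d by ring.
  by rewrite /dist1 lerD// distrC ltW// yd.
have d1 : d <= r / 4 by rewrite ge_min lexx.
have d2 : d * (8 * (M + 1)) <= e * r.
  by rewrite -ler_pdivlMr// ge_min lexx orbT.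
have ry : r / 2 <= rho (proj y).
  have := rho_lip (proj x) (proj y); rewrite -/r ler_norml => /andP[_].
  by move: dist d1; lra.
have rx : r / 2 <= rho (proj x) by rewrite -/r; move: r0; lra.
have := slow_diff sf rx ry; rewrite /comp.
have : M * dist1 (proj x) (proj y) <= M * (2 * d) by rewrite ler_wpM2l.
move: `|_ - _| => z h1 h2; rewrite -(ltr_pM2l r0).
have : M * (2 * d) * 4 <= d * (8 * (M + 1)) - 8 * d by lra.
nra.
Qed.

(** A slow function is continuous off the singular set and constant on it. *)
Lemma slow_measurable M f : slow M f -> measurable_fun [set: pt] (f \o proj).
Proof.
move=> sf; apply: (measurability _ (RGenOpens.measurableE R)).
move=> _ [_ [a [b ->] <-]]; rewrite setTI.
set J := `]a, b[%classic; pose Z : set pt :=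
  [set x | x ord0 axis1 = 0] `&` [set x | x ord0 axis2 = 0].
have mZ : measurable Z by apply: measurableI; exact: measurable_hyperplane0.
have notZ x : ~ Z x -> 0 < rho (proj x).
  move=> nZ; rewrite lt_neqAle rho_ge0 andbT eq_sym; apply/eqP => r0; apply: nZ.
  by split; apply/normr0_eq0/eqP; rewrite eq_le normr_ge0 andbT -r0;
    [exact: (norm_fst_le_rho (proj x))|exact: (norm_snd_le_rho (proj x))].
have oU : open (~` Z `&` (f \o proj) @^-1` J).
  have oZ : open (~` Z).
    rewrite /Z setCI; apply: openU; rewrite openC.
      have := @closed_comp _ _ (fun x : pt => x ord0 axis1) [set 0].
      apply; last by apply: accessible_closed_set1; exact: hausdorff_accessible.
      by move=> x _; exact: coord_continuous.
    have := @closed_comp _ _ (fun x : pt => x ord0 axis2) [set 0].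
    apply; last by apply: accessible_closed_set1; exact: hausdorff_accessible.
    by move=> x _; exact: coord_continuous.
  rewrite openE => x [nZ fx].
  have cx := slow_continuous sf (notZ _ nZ).
  apply: filterI; first exact: open_nbhs_nbhs.
  by apply: cx; apply: open_nbhs_nbhs; split=> //; exact: interval_open.
rewrite -[X in measurable X](setUIDK _ Z) setIC; apply: measurableU; last first.
  by rewrite setDE setIC; exact: open_measurable_rV.
have [J0|J0] := pselect (J (f (0, 0))).
  rewrite (_ : _ `&` _ = Z)//; apply/seteqP; split=> [x []//|x Zx].
  by split=> //; case: Zx => /= z0 z1; rewrite /proj z0 z1.
rewrite (_ : _ `&` _ = set0)//; apply/seteqP; split=> // x [[/= z0 z1]].
by rewrite /proj z0 z1.
Qed.

Lemma proj_line0 x t : proj (x + t *: delta_mx ord0 axis1) = (x ord0 axis1 + t, x ord0 axis2).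
Proof. by rewrite /proj !mxE !eqxx/= mulr1 mulr0 addr0. Qed.

Lemma proj_line1 x t : proj (x + t *: delta_mx ord0 axis2) = (x ord0 axis1, x ord0 axis2 + t).
Proof. by rewrite /proj !mxE !eqxx/= mulr1 mulr0 addr0. Qed.

Lemma proj_line2 x t a : a != axis1 -> a != axis2 ->
  proj (x + t *: delta_mx ord0 a) = proj x.
Proof.
move=> a0 a1; rewrite /proj !mxE !eqxx/= eq_sym (negbTE a0) eq_sym (negbTE a1).
by rewrite mulr0 !addr0.
Qed.

Lemma rho_gt0 x : x ord0 axis1 != 0 \/ x ord0 axis2 != 0 -> 0 < rho (proj x).
Proof.
case=> h; [apply: lt_le_trans (norm_fst_le_rho _)|apply: lt_le_trans (norm_snd_le_rho _)];
  by rewrite normr_gt0.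
Qed.

Lemma measurable_proj1 : measurable_fun setT (fun x : pt => (proj x).1).
Proof. exact: measurable_rV_coord. Qed.

Lemma measurable_proj2 : measurable_fun setT (fun x : pt => (proj x).2).
Proof. exact: measurable_rV_coord. Qed.

Lemma slow_profile c : slow (1 + `|c| * 2) (@profile R c).
Proof.
have := slowD (slow_cst 1) (slowZ c (@slow_sin R)).
by rewrite normr1.
Qed.

Lemma slow_comp_swap M f : slow M f -> slow M (f \o @swap R).
Proof. exact: slow_swap. Qed.

Definition sol_u c : pt -> R := @plane_u R c \o proj.
Definition sol_v c : pt -> R := @plane_u R c \o @swap R \o proj.

Lemma measurable_sol_u c : measurable_fun setT (sol_u c).
Proof.
by apply: measurable_funM; [exact: measurable_proj1|exact: slow_measurable (slow_profile c)].
Qed.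

Lemma measurable_sol_v c : measurable_fun setT (sol_v c).
Proof.
apply: measurable_funM; first exact: measurable_proj2.
exact: slow_measurable (slow_comp_swap (slow_profile c)).
Qed.

Definition Dom : set pt := eball 0 4.

Lemma Dom_coord x i : Dom x -> `|x ord0 i| <= 4.
Proof. by move=> Dx; have := eballP i Dx; rewrite !mxE subr0 => /ltW. Qed.

Lemma norm_profile c P : 0 <= c <= 16^-1 -> `|profile c P| <= 2.
Proof.
move=> /andP[c0 c1]; rewrite /profile; have := sin_max (phase P).
by rewrite !ler_norml => /andP[]; nra.
Qed.

Lemma norm_sol_u c x : 0 <= c <= 16^-1 -> Dom x -> `|sol_u c x| <= 66.
Proof.
move=> cc Dx; rewrite /sol_u /plane_u/= normrM.
have := ler_pM _ _ (Dom_coord axis1 Dx) (norm_profile (proj x) cc).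
by move=> /(_ (normr_ge0 _) (normr_ge0 _)) h; rewrite (le_trans h)//; lra.
Qed.

Lemma norm_sol_v c x : 0 <= c <= 16^-1 -> Dom x -> `|sol_v c x| <= 66.
Proof.
move=> cc Dx; rewrite /sol_v /plane_u/= normrM.
have := ler_pM _ _ (Dom_coord axis2 Dx) (norm_profile (swap (proj x)) cc).
by move=> /(_ (normr_ge0 _) (normr_ge0 _)) h; rewrite (le_trans h)//; lra.
Qed.

Lemma is_derive_shift (h : R -> R) (k t d : R) : is_derive (k + t) 1 h d ->
  is_derive t 1 (fun s => h (k + s)) d.
Proof.
move=> dh; have [h1 h2] := @is_derive_chain R h (fun s => k + s) t _ _ dh
  (is_derive_addc k (is_derive_id t 1)).
by apply: DeriveDef; [exact: h1|rewrite h2 mulr1].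
Qed.

Lemma slow_line_continuous M f x a b : slow M f -> a != b -> (b == axis1) || (b == axis2) ->
  x ord0 b != 0 -> continuous (fun t : R => f (proj (x + t *: delta_mx ord0 a))).
Proof.
move=> sf ab bi xb t.
pose line := fun s : R => x + s *: delta_mx ord0 a.
apply: (@continuous_comp _ _ _ line (f \o proj)); first exact: continuous_line.
apply: slow_continuous sf _; apply: rho_gt0.
have : (line t) ord0 b != 0.
  by rewrite !mxE eqxx/= [b == a]eq_sym (negbTE ab) mulr0 addr0.
by case/orP: bi => /eqP ->; [left|right].
Qed.

(** Lines of direction [a] in [x_b <> 0], [b] being one of the first two
    coordinates, avoid the singular set [x_1 = x_2 = 0]. *)
Lemma weak_pderiv_slow M f (w : pt -> R) a b :
  slow M f -> measurable_fun setT w -> (forall x, Dom x -> `|w x| <= M) ->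
  a != b -> (b == axis1) || (b == axis2) ->
  (forall (x : pt) (t : R), x ord0 b != 0 -> is_derive t 1 (fun s => w (x + s *: delta_mx ord0 a))
      (f (proj (x + t *: delta_mx ord0 a)))) ->
  weak_pderiv Dom a w (f \o proj).
Proof.
move=> sf mw wM ab bi dw.
apply: (@weak_pderiv_lines R _ Dom a b w (f \o proj) 4 M ab (slow_ge0 sf)) => //.
- exact: measurable_eball.
- exact: leb_eball_lty.
- exact: eball_sub_box.
- exact: slow_measurable sf.
- by move=> x _; exact: slow_bound sf _.
move=> x xb; split; last by move=> t; exact: dw.
exact: slow_line_continuous sf ab bi xb.
Qed.

Definition grad c (a : 'I_m.+2) : R * R -> R :=
  if a == axis1 then @dxu R c else if a == axis2 then @dyu R c else fun=> 0.

Lemma slow_grad c a : 0 <= c <= 16^-1 -> slow 66 (grad c a).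
Proof.
move=> cc; rewrite /grad; case: ifP => _; first exact: slow_dxu.
case: ifP => _; first exact: slow_dyu.
by apply: slow_le (slow_cst 0); rewrite normr0.
Qed.

Lemma weak_pderiv_sol_u c a : 0 <= c <= 16^-1 ->
  weak_pderiv Dom a (sol_u c) (grad c a \o proj).
Proof.
move=> cc; have su := slow_grad a cc; have mu := measurable_sol_u c.
have bu x : Dom x -> `|sol_u c x| <= 66 by exact: norm_sol_u.
have [a0|a0] := eqVneq a axis1.
  apply: (weak_pderiv_slow (b := axis2) su mu bu) => //; first by rewrite a0.
  move=> x t x1; rewrite a0 /grad eqxx proj_line0.
  under eq_fun do rewrite /sol_u/= proj_line0.
  by apply: (is_derive_shift (h := fun X => plane_u c (X, _))); exact: is_derive_plane_u_x.
have [a1|a1] := eqVneq a axis2.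
  apply: (weak_pderiv_slow (b := axis1) su mu bu) => //.
  move=> x t x0; rewrite a1 /grad eqxx/= proj_line1.
  under eq_fun do rewrite /sol_u/= proj_line1.
  by apply: (is_derive_shift (h := fun Y => plane_u c (_, Y))); exact: is_derive_plane_u_y.
apply: (weak_pderiv_slow (b := axis1) su mu bu) => //.
move=> x t _; rewrite /grad (negbTE a0) (negbTE a1).
under eq_fun do rewrite /sol_u/= (proj_line2 _ _ a0 a1).
exact: is_derive_cst.
Qed.

Lemma weak_pderiv_sol_v1 c : 0 <= c <= 16^-1 ->
  weak_pderiv Dom axis1 (sol_v c) (@dyu R c \o proj).
Proof.
move=> cc; have su := slow_dyu cc; have mu := measurable_sol_v c.
have bu x : Dom x -> `|sol_v c x| <= 66 by exact: norm_sol_v.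
apply: (weak_pderiv_slow (b := axis2) su mu bu) => // x t x1.
rewrite proj_line0 -dyu_swap/=.
under eq_fun do rewrite /sol_v/= proj_line0.
by apply: (is_derive_shift (h := fun X => plane_u c (_, X))); exact: is_derive_plane_u_y.
Qed.

Lemma slow_dyv c : 0 <= c <= 16^-1 -> slow 66 (@dyv R c).
Proof.
move=> cc; rewrite (_ : dyv c = dxu c \o @swap R); first exact/slow_comp_swap/slow_dxu.
by apply/funext => P; rewrite /= dxu_swap.
Qed.

Lemma weak_pderiv_sol_v2 c : 0 <= c <= 16^-1 ->
  weak_pderiv Dom axis2 (sol_v c) (@dyv R c \o proj).
Proof.
move=> cc; have su := slow_dyv cc; have mu := measurable_sol_v c.
have bu x : Dom x -> `|sol_v c x| <= 66 by exact: norm_sol_v.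
apply: (weak_pderiv_slow (b := axis1) su mu bu) => // x t x0.
rewrite proj_line1 -dxu_swap/=.
under eq_fun do rewrite /sol_v/= proj_line1.
by apply: (is_derive_shift (h := fun X => plane_u c (X, _))); exact: is_derive_plane_u_x.
Qed.

End slow_rV.

(** * The integral condition *)

Section dini_integral.
Variable R : realType.
Local Notation mu := (@lebesgue_measure R).
Implicit Types (t s r kappa C : R).

(** The integral of a nonnegative function is a supremum over the simple
    functions below it, hence is monotone among arbitrary functions.  This suits
    the modulus [omega2], a supremum over uncountably many balls. *)
Lemma ge0_le_integral_nonmeas d (T : measurableType d)
    (nu : {measure set T -> \bar R}) (D : set T) (f1 f2 : T -> \bar R) :
  (forall x, D x -> 0 <= f1 x)%E -> (forall x, D x -> f1 x <= f2 x)%E ->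
  (\int[nu]_(x in D) f1 x <= \int[nu]_(x in D) f2 x)%E.
Proof.
move=> f10 f12; rewrite !ge0_integralE//; last first.
  by move=> x Dx; rewrite (le_trans (f10 _ Dx))// f12.
apply: le_ereal_sup => _ [h hf <-]; exists h => // x.
apply: le_trans (hf x) _; rewrite !patchE; case: ifPn => //.
by rewrite inE; exact: f12.
Qed.

Lemma Rintegral_le_primitive (f h H : R -> R) (a b : R) : a <= b ->
  (forall x, a <= x <= b -> 0 <= f x) -> (forall x, a <= x <= b -> f x <= h x) ->
  (forall x, a <= x <= b -> is_derive x 1 H (h x)) ->
  {in `[a, b], continuous h} ->
  0 <= \int[mu]_(x in `[a, b]) f x <= H b - H a.
Proof.
move=> ab f0 fh dH ch; rewrite Rintegral_ge0/=; last first.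
  by move=> x; rewrite /= in_itv/=; exact: f0.
move: ab; rewrite le_eqVlt => /predU1P[ab|ab].
  by rewrite -ab subrr set_itv1 Rintegral_set1.
have cH x : a <= x <= b -> {for x, continuous H}.
  move=> xab; apply: differentiable_continuous; apply/derivable1_diffP.
  exact: (ex_derive (is_derive := dH _ xab)).
have E : (\int[mu]_(x in `[a, b]) (h x)%:E = (H b)%:E - (H a)%:E)%E.
  apply: continuous_FTC2 => //.
  - by apply: continuous_in_subspaceT => x; rewrite inE/=; exact: ch.
  - split.
    + move=> x /itvP h1; apply: (ex_derive (is_derive := dH x _)).
      by rewrite !ltW ?h1.
    + by apply/cvg_at_right_filter/cH; rewrite lexx ltW.
    + by apply/cvg_at_left_filter/cH; rewrite lexx ltW.
  - move=> x /itvP h1; rewrite derive1E; apply: (derive_val (is_derive := dH x _)).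
    by rewrite !ltW ?h1.
have le : (\int[mu]_(x in `[a, b]) (f x)%:E <= (H b - H a)%:E)%E.
  rewrite EFinB -E; apply: ge0_le_integral_nonmeas => x; rewrite /= in_itv/= => xab.
    by rewrite lee_fin f0.
  by rewrite lee_fin fh.
have ge : (0 <= \int[mu]_(x in `[a, b]) (f x)%:E)%E.
  by apply: integral_ge0 => x; rewrite /= in_itv/= => xab; rewrite lee_fin f0.
rewrite /Rintegral -[leRHS]/(fine (H b - H a)%:E) fine_le//.
by rewrite ge0_fin_numE// (le_lt_trans le)// ltry.
Qed.

Lemma dlnslogE s : 0 < s -> dlnslog s = - (s * (1 + s) * slog s)^-1.
Proof.
move=> s0; have L0 := slog_gt0 (ltW s0).
by rewrite /dlnslog; field; rewrite !gt_eqF// addr_gt0.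
Qed.

Lemma slog_continuous s : 0 < s -> {for s, continuous (@slog R)}.
Proof.
move=> s0; apply: cvgD; first exact: cvg_cst.
have s10 : 0 < 1 + s^-1 by rewrite addr_gt0// invr_gt0.
apply: (@continuous_comp _ _ _ (fun s : R => 1 + s^-1) (@ln R)).
  by apply: cvgD; [exact: cvg_cst|apply: cvgV; [rewrite gt_eqF|exact: cvg_id]].
exact: continuous_ln.
Qed.

Lemma dlnslog_continuous s : 0 < s -> {for s, continuous (@dlnslog R)}.
Proof.
move=> s0; have L0 := slog_gt0 (ltW s0).
have cinv : {for s, continuous (fun s : R => s^-1)}.
  by apply: cvgV; [rewrite gt_eqF|exact: cvg_id].
apply: cvgM; first by apply: cvgV; [rewrite gt_eqF|exact: slog_continuous].
apply: cvgM.
  apply: cvgV; first by rewrite gt_eqF// addr_gt0// invr_gt0.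
  by apply: cvgD; [exact: cvg_cst|exact: cinv].
apply: cvgN; apply: cvgV; first by rewrite expf_neq0// gt_eqF.
exact: exprn_continuous.
Qed.

(** [(slog t) ^ (- 1 / 2)], written so that it differentiates easily. *)
Definition isqrt_slog t : R := expR (- (2^-1 * ln (slog t))).

Lemma isqrt_slog_gt0 t : 0 < isqrt_slog t. Proof. exact: expR_gt0. Qed.

Lemma is_derive_isqrt_slog t : 0 < t ->
  is_derive t 1 isqrt_slog (isqrt_slog t * (- 2^-1 * dlnslog t)).
Proof.
move=> t0; have d1 := is_derive_scale (- 2^-1) (is_derive_lnslog t0).
have d2 := @is_derive_chain _ (@expR R) (fun t => - 2^-1 * ln (slog t)) t _ _
  (is_derive_expR _) d1.
rewrite (_ : isqrt_slog = fun t => expR (- 2^-1 * ln (slog t))).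
  exact: d2.
by apply/funext => z; rewrite /isqrt_slog mulNr.
Qed.

Lemma isqrt_slog_continuous t : 0 < t -> {for t, continuous isqrt_slog}.
Proof.
move=> t0; apply: differentiable_continuous; apply/derivable1_diffP.
exact: (ex_derive (is_derive := is_derive_isqrt_slog t0)).
Qed.

Section dini.
Variables (om : R -> R) (kappa C : R).
Hypotheses (k0 : 0 <= kappa) (C0 : 0 < C) (kC : 6 * kappa * C <= 1).
Hypothesis om_bound : forall t, 0 < t <= 2 -> 0 <= om t <= kappa / slog t.

(** For [s <= 2], [1 / (s * slog s)] is at most [3 / (s * (1 + s) * slog s)],
    which is minus three times the derivative of [ln (slog s)]. *)
Lemma inner_integral_bound t : 0 < t <= 2 ->
  0 <= \int[mu]_(s in `[t, 2]) (om s / s) <= 3 * kappa * ln (slog t).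
Proof.
move=> /andP[t0 t2].
pose H s : R := - (3 * kappa) * ln (slog s).
have /andP[h0 h1] : 0 <= \int[mu]_(s in `[t, 2]) (om s / s) <= H 2 - H t.
  apply: (Rintegral_le_primitive (h := fun s => - (3 * kappa) * dlnslog s) t2).
  - move=> s /andP[ts s2]; have s0 := lt_le_trans t0 ts.
    have /andP[w0 _] := om_bound (introT andP (conj s0 s2)).
    by rewrite mulr_ge0// invr_ge0 ltW.
  - move=> s /andP[ts s2]; have s0 := lt_le_trans t0 ts.
    have /andP[_ w1] := om_bound (introT andP (conj s0 s2)).
    have L0 := slog_gt0 (ltW s0).
    rewrite dlnslogE// mulNr mulrN opprK ler_pdivrMr// (le_trans w1)//.
    have -> : 3 * kappa / (s * (1 + s) * slog s) * s = kappa / slog s * (3 / (1 + s)).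
      by field; rewrite !gt_eqF// addr_gt0.
    have a0 : 0 <= kappa / slog s by rewrite divr_ge0// ltW.
    rewrite ler_peMr// ler_pdivlMr ?addr_gt0//.
    by rewrite mul1r (_ : 3 = 1 + 2) ?lerD2l//; ring.
  - move=> s /andP[ts s2]; have s0 := lt_le_trans t0 ts.
    exact/is_derive_scale/is_derive_lnslog.
  - move=> s; rewrite in_itv/= => /andP[ts s2]; have s0 := lt_le_trans t0 ts.
    by apply: cvgM; [exact: cvg_cst|exact: dlnslog_continuous].
rewrite h0/= (le_trans h1)// /H !mulNr opprK addrC gerBl mulr_ge0 ?mulr_ge0//.
by rewrite ln_ge0// slog_ge1.
Qed.

(** By [inner_integral_bound] and the smallness of [kappa * C], the exponential is
    at most the square root of [slog t], so the integrand is at most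
    [kappa * isqrt_slog t / t ^ 2].  The derivative of [- 2 * isqrt_slog t / t]
    dominates [isqrt_slog t / t ^ 2] because [isqrt_slog] varies slowly. *)
Lemma outer_integral_bound r : 0 < r <= 2 ->
  0 <= r * \int[mu]_(t in `[r, 2]) (om t / t ^+ 2 *
          expR (C * \int[mu]_(s in `[t, 2]) (om s / s))) <= 2 * kappa * isqrt_slog r.
Proof.
move=> /andP[r0 r2].
have int_ge0 t : 0 < t <= 2 -> 0 <= om t / t ^+ 2 *
          expR (C * \int[mu]_(s in `[t, 2]) (om s / s)).
  move=> tt; have /andP[w0 _] := om_bound tt.
  by rewrite mulr_ge0 ?expR_ge0// divr_ge0// sqr_ge0.
have int_le t : 0 < t <= 2 -> om t / t ^+ 2 *
    expR (C * \int[mu]_(s in `[t, 2]) (om s / s)) <= kappa * (isqrt_slog t / t ^+ 2).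
  move=> tt; have /andP[w0 w1] := om_bound tt; have /andP[t0 t2] := tt.
  have L0 := slog_gt0 (ltW t0); have L1 := slog_ge1 (ltW t0).
  have /andP[j0 j1] := inner_integral_bound tt.
  have ln0 : 0 <= ln (slog t) by rewrite ln_ge0.
  have E : expR (C * \int[mu]_(s in `[t, 2]) (om s / s)) <= slog t * isqrt_slog t.
    rewrite -{1}[slog t](@lnK R) ?posrE// /isqrt_slog -expRD ler_expR.
    have : C * \int[mu]_(s in `[t, 2]) (om s / s) <= C * (3 * kappa * ln (slog t)).
      by rewrite ler_wpM2l// ltW.
    have kCl : 6 * kappa * C * ln (slog t) <= 1 * ln (slog t) by rewrite ler_wpM2r.
    move: kCl; rewrite mul1r => kCl h; rewrite (le_trans h)//; lra.
  rewrite (le_trans (ler_pM _ (expR_ge0 _) (lexx _) E)) ?divr_ge0 ?sqr_ge0//.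
  have : om t * slog t <= kappa by rewrite -ler_pdivlMr.
  move=> h; rewrite [leLHS](_ : _ = (om t * slog t) * (isqrt_slog t / t ^+ 2)); last by ring.
  by rewrite ler_wpM2r// divr_ge0 ?sqr_ge0// ltW// isqrt_slog_gt0.
pose h t : R := - (2 * kappa) * ((isqrt_slog t * (- 2^-1 * dlnslog t)) * t^-1 + isqrt_slog t * - t ^- 2).
have dH t : 0 < t -> is_derive t 1 (fun t => - (2 * kappa) * (isqrt_slog t * t^-1)) (h t).
  move=> t0; apply: is_derive_scale.
  have tn0 : t != 0 by rewrite gt_eqF.
  have [h1 h2] := is_derive_mul (is_derive_isqrt_slog t0) (is_deriveV tn0 (is_derive_id t 1)).
  apply: DeriveDef; first exact: h1.
  by rewrite h2 /GRing.scale/= mulr1 addrC [X in X + _]mulrC.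
have hE t : 0 < t -> kappa * (isqrt_slog t / t ^+ 2) <= h t.
  move=> t0; have L1 := slog_ge1 (ltW t0); have L0 := slog_gt0 (ltW t0).
  rewrite /h dlnslogE//.
  rewrite [leRHS](_ : _ = kappa * (isqrt_slog t / t ^+ 2) * (2 - ((1 + t) * slog t)^-1)); last first.
    by field; rewrite !gt_eqF// addr_gt0.
  have a0 : 0 <= kappa * (isqrt_slog t / t ^+ 2).
    by rewrite mulr_ge0// divr_ge0 ?sqr_ge0// ltW// isqrt_slog_gt0.
  rewrite ler_peMr//.
  have q1 : 1 <= (1 + t) * slog t by rewrite mulr_ege1// lerDl ltW.
  have q2 : ((1 + t) * slog t)^-1 <= 1 by rewrite invf_le1// (lt_le_trans ltr01 q1).
  by move: q2; move: (_^-1) => z q2; lra.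
pose H t : R := - (2 * kappa) * (isqrt_slog t * t^-1).
have /andP[h0 h1] : 0 <= \int[mu]_(t in `[r, 2]) (om t / t ^+ 2 *
    expR (C * \int[mu]_(s in `[t, 2]) (om s / s))) <= H 2 - H r.
  apply: (Rintegral_le_primitive (h := h) r2).
  - by move=> t /andP[rt t2]; rewrite int_ge0// t2 (lt_le_trans r0 rt).
  - move=> t /andP[rt t2]; have t0 := lt_le_trans r0 rt.
    by rewrite (le_trans _ (hE _ t0))// int_le// t0.
  - by move=> t /andP[rt t2]; apply: dH; exact: lt_le_trans rt.
  - move=> t; rewrite in_itv/= => /andP[rt t2]; have t0 := lt_le_trans r0 rt.
    have cinv : {for t, continuous (fun s : R => s^-1)}.
      by apply: cvgV; [rewrite gt_eqF|exact: cvg_id].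
    have cw := isqrt_slog_continuous t0.
    apply: cvgM; first exact: cvg_cst.
    apply: cvgD; apply: cvgM.
    + apply: cvgM; first exact: cw.
      by apply: cvgM; [exact: cvg_cst|exact: dlnslog_continuous].
    + exact: cinv.
    + exact: cw.
    + apply: cvgN; apply: cvgV; first by rewrite expf_neq0// gt_eqF.
      exact: exprn_continuous.
rewrite mulr_ge0 ?(ltW r0)//=.
apply: (@le_trans _ _ (r * (2 * kappa * (isqrt_slog r * r^-1)))).
  rewrite ler_pM2l// (le_trans h1)// /H !mulNr opprK addrC gerBl.
  by rewrite !mulr_ge0 ?invr_ge0 ?(ltW (isqrt_slog_gt0 _)).
by rewrite le_eqVlt; apply/orP; left; apply/eqP; field; rewrite gt_eqF.
Qed.

Lemma slog_large (T r : R) : 0 < r -> r <= expR (- T) -> T <= slog r.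
Proof.
move=> r0 rT; apply: (@le_trans _ _ (ln r^-1)).
  by rewrite -[T]expRK ler_ln ?posrE ?expR_gt0 ?invr_gt0// -[T]opprK expRN lef_pV2
    ?posrE ?expR_gt0.
rewrite /slog (@le_trans _ _ (ln (1 + r^-1)))// ?lerDr//.
by rewrite ler_ln ?posrE ?invr_gt0 ?addr_gt0 ?invr_gt0// lerDr.
Qed.

Lemma isqrt_slog_sqr t : 0 < t -> isqrt_slog t ^+ 2 = (slog t)^-1.
Proof.
move=> t0; rewrite /isqrt_slog -expRM_natl mulrN mulrA divff// mul1r expRN lnK//.
by rewrite posrE slog_gt0// ltW.
Qed.

Lemma dini_limsup : limf_esup (fun r : R =>
  (r * \int[mu]_(t in `[r, 2]) (om t / t ^+ 2 *
     expR (C * \int[mu]_(s in `[t, 2]) (om s / s))))%:E) 0^'+ = 0%E.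
Proof.
set f := fun r : R => _.
apply/eqP; rewrite eq_le; apply/andP; split; last first.
  apply: le_ereal_inf_tmp => _ [V nV <-].
  have : \forall r \near 0^'+, V r /\ 0 < r <= 2.
    near=> r; split; first by near: r.
    by apply/andP; split; near: r; [exact: nbhs_right_gt|exact: nbhs_right_le].
  move=> /filter_ex[r [Vr /outer_integral_bound/andP[f0 _]]].
  apply: (@le_trans _ _ (f r)); first by rewrite lee_fin.
  by apply: ereal_sup_ubound; exists r.
apply/lee_addgt0Pr => e e0; rewrite add0e.
pose k := 2 * kappa + 1; have k1 : 0 < k by rewrite ltr_wpDl// mulr_ge0.
pose d := Num.min 2 (expR (- (k / e) ^+ 2)).
have d0 : 0 < d by rewrite lt_min expR_gt0 ltr0n.
apply: (@le_trans _ _ (ereal_sup [set f r | r in [set r | 0 < r < d]])).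
  apply: ereal_inf_lbound; exists [set r | 0 < r < d] => //.
  near=> r; apply/andP; split; near: r; [exact: nbhs_right_gt|exact: nbhs_right_lt].
apply: ge_ereal_sup => _ [r /andP[r0 rd] <-]; rewrite lee_fin.
have r2 : 0 < r <= 2 by rewrite r0 (le_trans (ltW rd))// ge_min lexx.
have /andP[_ h] := outer_integral_bound r2; apply: (le_trans h).
have W0 := ltW (isqrt_slog_gt0 r).
have ke0 : 0 < k / e by rewrite divr_gt0.
have W1 : isqrt_slog r <= (k / e)^-1.
  rewrite -(@ler_pXn2r _ 2%N)// ?nnegrE ?invr_ge0 ?(ltW ke0)// isqrt_slog_sqr//.
  rewrite exprVn lef_pV2 ?posrE ?exprn_gt0// ?slog_gt0 ?(ltW r0)//.
  by apply: slog_large => //; rewrite (le_trans (ltW rd))// ge_min lexx orbT.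
apply: (@le_trans _ _ (k * (k / e)^-1)).
  by rewrite ler_pM ?mulr_ge0// lerDl.
by rewrite invf_div mulrCA divff ?gt_eqF// mulr1.
Unshelve. all: by end_near. Qed.

End dini.
End dini_integral.

(** * The coefficients and the gradient as functions of row vectors *)

Section coefficients.
Variables (R : realType) (m N : nat) (c : R).
Hypothesis cc : 0 <= c <= 16^-1.
Local Notation pt := 'rV[R]_m.+2.
Local Notation leb := (@lebesgue_rV R m.+2).
Implicit Types (x y z : pt) (P Q : R * R) (s t r e : R).

Let c0 : 0 <= c. Proof. by case/andP: cc. Qed.
Let C0 : 0 <= osc_const R := osc_const_ge0 R.

Definition dcoef (a b : 'I_m.+2) : R * R -> R :=
  if b == axis1 m then (if a == axis1 m then acol1 c else if a == axis2 m then acol2 c else fun=> 0)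
  else fun=> 0.

Lemma slow_dcoef a b : slow (c * slow_const R) (dcoef a b).
Proof.
have s0 : slow (c * slow_const R) (fun=> 0 : R).
  by apply: slow_le (slow_cst 0); rewrite normr0 mulr_ge0// slow_const_ge0.
rewrite /dcoef; case: ifP => // _; case: ifP => _; first exact: slow_acol1.
by case: ifP => // _; exact: slow_acol2.
Qed.

Lemma dcoef_small a b P s : 0 < s -> nsq P <= s -> `|dcoef a b P| <= c * 8 / slog s.
Proof.
move=> s0 Ps.
have s00 : `|0 : R| <= c * 8 / slog s.
  rewrite normr0; apply: mulr_ge0; first exact: mulr_ge0.
  by rewrite invr_ge0 ltW// slog_gt0// ltW.
rewrite /dcoef; case: ifP => // _; case: ifP => _; first exact: norm_acol1.
by case: ifP => // _; exact: norm_acol2.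
Qed.

Lemma dcoef_le8 a b P : `|dcoef a b P| <= c * 8.
Proof.
have s0 : 0 < nsq P + 1 by rewrite ltr_wpDl ?nsq_ge0.
have Ps : nsq P <= nsq P + 1 by rewrite lerDl.
apply: le_trans (dcoef_small a b s0 Ps) _; rewrite ler_piMr//.
  exact: mulr_ge0.
by rewrite invf_le1 ?slog_gt0 ?slog_ge1// ltW.
Qed.

(** On the singular set, continuity comes from [dcoef_small] and the blow-up of
    [slog] at [0]. *)
Lemma dcoef_continuous a b : continuous (dcoef a b \o @proj R m).
Proof.
move=> x; have := nsq_ge0 (proj x); rewrite le_eqVlt => /predU1P[x0|]; last first.
  by rewrite nsq_gt0; exact: slow_continuous (slow_dcoef a b).
apply/(@cvgrPdist_lt _ _ _ (nbhs x)) => e e0; apply/nbhs_ballP.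
pose s := expR (- (2 / e)).
have s0 : 0 < s by exact: expR_gt0.
have L0 := slog_gt0 (ltW s0).
have Ls : 2 / e <= slog s by exact: slog_large.
have small z : nsq (proj z) <= s -> `|dcoef a b (proj z)| <= e / 4.
  move=> zs; apply: le_trans (dcoef_small a b s0 zs) _.
  rewrite ler_pdivrMr//; apply: (@le_trans _ _ (e / 4 * (2 / e))).
    rewrite [leRHS](_ : _ = 2^-1); last by field; rewrite gt_eqF.
    by case/andP: cc => _; lra.
  by rewrite ler_wpM2l// divr_ge0// ltW.
exists (Num.sqrt s / 2); first by rewrite /= divr_gt0// sqrtr_gt0.
move=> y; rewrite ball_rVE ?divr_gt0 ?sqrtr_gt0// => /boxP yd.
have /eqP : rho (proj x) = 0 by rewrite /rho -x0 sqrtr0.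
rewrite eq_le rho_ge0 andbT => rx0.
have px : (proj x).1 = 0 /\ (proj x).2 = 0.
  by split; apply/normr0_eq0/eqP; rewrite eq_le normr_ge0 andbT (le_trans _ rx0)//;
    [exact: norm_fst_le_rho|exact: norm_snd_le_rho].
have ry : rho (proj y) <= Num.sqrt s.
  rewrite (le_trans (rho_le_norm _))//.
  have := yd (axis1 m); have := yd (axis2 m).
  rewrite (_ : x ord0 (axis1 m) = 0); last exact: px.1.
  rewrite (_ : x ord0 (axis2 m) = 0); last exact: px.2.
  by rewrite !subr0 /proj/=; lra.
have ys : nsq (proj y) <= s.
  by rewrite -rho_sqr -[leRHS]sqr_sqrtr ?(ltW s0)// ler_pXn2r ?nnegrE ?rho_ge0 ?sqrtr_ge0.
have xs : nsq (proj x) <= s by rewrite -x0 ltW.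
apply: (@le_lt_trans _ _ (e / 4 + e / 4)); last by lra.
by rewrite (le_trans (ler_normB _ _))// lerD//; exact: small.
Qed.

Definition Acoef : coeffs R m.+2 N := fun k x =>
  let: (i, j, a, b) := k in (i == j)%:R * ((a == b)%:R + dcoef a b (proj x)).

Lemma Acoef_continuous k : continuous (Acoef k).
Proof.
case: k => [[[i j] a] b] x.
have cst_c (k : R) : {for x, continuous (fun=> k : R)} by exact: cst_continuous.
exact: (continuousM (cst_c (i == j)%:R)
  (continuousD (cst_c (a == b)%:R) (@dcoef_continuous a b x))).
Qed.

Lemma Acoef_measurable k : measurable_fun setT (Acoef k).
Proof. by apply: continuous_measurable_rV; exact: Acoef_continuous. Qed.

Lemma Acoef_le2 k x : `|Acoef k x| <= 2.
Proof.
case: k => [[[i j] a] b] /=; rewrite normrM.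
have b1 (u : bool) : `|u%:R : R| <= 1 by case: u; rewrite ?normr1 ?normr0.
rewrite -[leRHS]mul1r; apply: ler_pM => //.
rewrite (le_trans (ler_normD _ _))// (_ : 2 = 1 + 1)//; apply: lerD => //.
by rewrite (le_trans (dcoef_le8 _ _ _))//; case/andP: cc => _; lra.
Qed.

Definition ncoef : R := #|{: 'I_N * 'I_N * 'I_m.+2 * 'I_m.+2}|%:R.

Lemma dist1_eball x y z r : eball x r y -> eball x r z ->
  dist1 (proj y) (proj z) <= 4 * r.
Proof.
move=> Dy Dz; have d i : `|y ord0 i - z ord0 i| <= 2 * r.
  have := eballP i Dy; have := eballP i Dz; rewrite !ltr_norml => /andP[? ?] /andP[? ?].
  by rewrite ler_norml; apply/andP; split; lra.
have := d (axis1 m); have := d (axis2 m); rewrite /dist1 /proj/=; lra.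
Qed.

Lemma Acoef_omega t : 0 < t <= 2 ->
  0 <= omega2 Acoef t <= ncoef * (c * osc_const R) / slog t.
Proof.
move=> /[dup] tt /andP[t0 t2]; rewrite -mulrA; apply: omega2_bound => //.
- apply: mulr_ge0; first exact: mulr_ge0.
  by rewrite invr_ge0 ltW// slog_gt0// ltW.
- exact: Acoef_measurable.
- by move=> k; exists 2 => y; exact: Acoef_le2.
have aux (k q v w : R) : k * (q + v) - k * (q + w) = k * (v - w) by ring.
move=> x y z _ Dy Dz [[[i j] a] b] /=; rewrite aux normrM.
apply: (@le_trans _ _ (1 * `|dcoef a b (proj y) - dcoef a b (proj z)|)).
  by rewrite ler_wpM2r//; case: (i == j); rewrite ?normr1 ?normr0.
rewrite mul1r; apply: (slow_log_osc cc (slow_dcoef a b)) => //.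
  by move=> P s; exact: dcoef_small.
exact: dist1_eball Dy Dz.
Qed.

Definition Dgrad (k : 'I_N * 'I_m.+2) x : R := grad c k.2 (proj x).

Lemma Dgrad_measurable k : measurable_fun setT (Dgrad k).
Proof. exact: slow_measurable (slow_grad k.2 cc). Qed.

Lemma Dgrad_le k x : `|Dgrad k x| <= 66.
Proof. exact: slow_bound (slow_grad k.2 cc) _. Qed.

Lemma Dgrad_BMO D : BMO D Dgrad.
Proof.
split=> [x r k r0 _|].
  apply: (integrable_eball (M := 66)); first exact: Dgrad_measurable.
  by move=> y _; exact: Dgrad_le.
exists (#|{: 'I_N * 'I_m.+2}|%:R * (66 + 66 + 4 * 66 * 0)) => x r r0 _.
apply: (@mean_osc_bound _ _ _ _ _ _ set0) => //.
- exact: Dgrad_measurable.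
- by move=> k y; exact: Dgrad_le.
- by rewrite setI0 measure0 mul0r.
move=> y z _ _ _ _ k; rewrite (le_trans (ler_normB _ _))//.
by apply: lerD; exact: Dgrad_le.
Qed.

(** Outside a strip around the hyperplane [x_1 = 0], of relative width [ep], either
    both points are near the singular set and [grad_osc] applies with a large
    [slog s], or both are at distance at least [u / 2] from it, where the gradient
    is Lipschitz.  The strip contributes its relative volume, [O(ep)]. *)
Lemma Dgrad_VMO D : VMO D Dgrad.
Proof.
split; first exact: Dgrad_BMO.
move=> e e0; pose nk : R := #|{: 'I_N * 'I_m.+2}|%:R.
have nk0 : 0 <= nk by exact: ler0n.
have nk1 : 0 < nk + 1 by rewrite ltr_wpDl.
pose h := e / (nk + 1) / 2; have h0 : 0 < h by rewrite !divr_gt0.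
pose v : R := m.+3%:R ^+ m.+2.
have v0 : 0 < v by rewrite exprn_gt0.
(* [K] abbreviates the factor [4 * M] of [mean_osc_bound]: [M = 66] bounds the
   gradient. *)
have [K K0 KE] : exists2 K : R, 0 < K & 4 * 66 = K.
  by exists (4 * 66) => //; apply: mulr_gt0; rewrite ltr0n.
pose ep := h / (K * v); have ep0 : 0 < ep.
  by apply: divr_gt0 => //; exact: mulr_gt0.
pose T := (8 / ep + 4) / h.
pose s := expR (- T); have s0 : 0 < s by exact: expR_gt0.
have L0 := slog_gt0 (ltW s0).
have hs : (8 / ep + 4) / slog s <= h.
  rewrite ler_pdivrMr//.
  by rewrite [leRHS]mulrC -ler_pdivrMr//; exact: slog_large.
pose u := Num.sqrt s; have u0 : 0 < u by rewrite sqrtr_gt0.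
have uu : u ^+ 2 = s by rewrite sqr_sqrtr// ltW.
have K20 : 0 < 2 * K by rewrite mulr_gt0.
pose d := Num.min (u / 8) (h * u / (2 * K)).
exists d.
  rewrite lt_min; apply/andP; split; first by rewrite divr_gt0.
  by apply: divr_gt0 => //; exact: mulr_gt0.
move=> x r /andP[r0 rd] _.
have rd1 : r <= u / 8 by rewrite (le_trans (ltW rd))// ge_min lexx.
have rd2 : 2 * K * r <= h * u.
  by rewrite [leLHS]mulrC -ler_pdivlMr// (le_trans (ltW rd))// ge_min lexx orbT.
apply: (@le_trans _ _ (nk * (h + 4 * 66 * (ep * v)))); last first.
  rewrite KE [X in nk * X](_ : _ = e / (nk + 1)); last first.
    by rewrite /ep /h; field; rewrite !gt_eqF.
  by rewrite mulrCA ler_piMr ?(ltW e0)// ler_pdivrMr// mul1r lerDl.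
pose S : set pt := [set y | (`|y ord0 (axis1 m)| < ep * r)%R].
have nS y : ~ S y -> ep * r <= rho (proj y).
  move=> /negP; rewrite -leNgt => h1.
  exact: (le_trans h1 (norm_fst_le_rho (proj y))).
apply: (@mean_osc_bound _ _ _ _ _ _ S).
- exact: r0.
- exact: ltW.
- exact: ler0n.
- by apply: mulr_ge0; exact: ltW.
- have := @measurable_rV_coord _ R m.+2 (axis1 m) measurableT _
    (@measurable_itv R `]- (ep * r), ep * r[).
  rewrite setTI /S; congr measurable; apply/seteqP; split=> y /=;
    by rewrite in_itv/= ltr_norml.
- exact: Dgrad_measurable.
- by move=> k y; exact: Dgrad_le.
- exact: strip_measure.
move=> y z Dy Dz /nS Sy /nS Sz k.
have dd := dist1_eball Dy Dz.
have near P Q : ep * r <= rho P -> ep * r <= rho Q -> dist1 P Q <= 4 * r ->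
    rho P <= u / 2 -> `|grad c k.2 P - grad c k.2 Q| <= h.
  move=> P0 Q0 PQ Pu.
  have Ps : nsq P <= s.
    rewrite -rho_sqr -uu ler_pXn2r ?nnegrE ?rho_ge0 ?(ltW u0)//.
    by move: Pu u0; lra.
  have Qs : nsq Q <= s.
    rewrite -rho_sqr -uu ler_pXn2r ?nnegrE ?rho_ge0 ?(ltW u0)//.
    have := rho_lip Q P; rewrite ler_norml dist1C => /andP[_].
    by move: Pu PQ rd1; lra.
  have [g1 g2] := grad_osc cc ep0 r0 P0 Q0 PQ s0 Ps Qs.
  rewrite /grad; case: ifP => _; first exact: (le_trans _ hs).
  case: ifP => _; first exact: (le_trans _ hs).
  by rewrite subrr normr0 ltW.
have [yu|uy] := leP (rho (proj y)) (u / 2); first exact: near.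
have [zu|uz] := leP (rho (proj z)) (u / 2).
  by rewrite distrC; apply: near => //; rewrite dist1C.
have := slow_diff (slow_grad k.2 cc) (ltW uy) (ltW uz) => sd.
have : u / 2 * `|Dgrad k y - Dgrad k z| <= u / 2 * h.
  apply: le_trans sd _; apply: (@le_trans _ _ (66 * (4 * r))).
    by apply: ler_wpM2l => //; exact: ler0n.
  rewrite [66 * _]mulrA [66 * 4]mulrC KE; move: rd2; clear; move=> rd2; lra.
by rewrite ler_pM2l// divr_gt0.
Qed.

End coefficients.

(** * Discontinuity of the gradient *)

Section discontinuity.
Variables (R : realType) (m : nat).
Local Notation pt := 'rV[R]_m.+2.
Local Notation leb := (@lebesgue_rV R m.+2).
Implicit Types (x y z : pt) (t d : R).

(** Nonempty open sets have positive measure. *)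
Lemma ae_meets_nbhs (A B : set pt) x : {ae leb, forall y, A y} -> nbhs x B ->
  exists2 y, B y & A y.
Proof.
move=> [Z [mZ Z0 AZ]] /nbhs_ballP[e /= e0 xeB].
have oB : open (ball x e) by exact: ball_open.
have pos : (0 < leb (ball x e))%E by apply: open_leb_gt0 oB _; exact: ballxx.
apply: contrapT => no; suff : (leb (ball x e) <= leb Z)%E by rewrite Z0 leNgt pos.
apply: le_measure; rewrite ?inE//; first exact: open_measurable_rV.
by move=> y /xeB By; apply: AZ => /= Ay; apply: no; exists y.
Qed.

(** The equation [ln (slog (t ^ 2)) = Z] is solved explicitly for [t], and the
    solution is small when [Z] is large: take [Z = theta] modulo [2 * pi]. *)
Lemma small_phase (theta d : R) : 0 < d -> exists2 t, 0 < t < d &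
  sin (ln (slog (t ^+ 2))) = sin theta.
Proof.
move=> d0; have d20 : 0 < d ^+ 2 by rewrite exprn_gt0.
pose k := Num.truncn (`|theta| + (d ^+ 2)^-1 + 1).
pose Z := theta + (pi *+ 2) *+ k.+1.
have Zd : (d ^+ 2)^-1 + 1 < Z.
  have hk := archimedean.Num.Theory.truncnS_gt (`|theta| + (d ^+ 2)^-1 + 1).
  have pk : k.+1%:R <= (pi *+ 2) *+ k.+1 :> R.
    by rewrite lerMn2r /= mulr2n; have := pi_ge2 R; lra.
  have := ler_norm (- theta); rewrite normrN /Z; move: hk; rewrite -/k; lra.
have di0 : 0 < (d ^+ 2)^-1 by rewrite invr_gt0.
have Z1 : 1 < Z by rewrite (lt_trans _ Zd)// ltrDr.
pose W := expR (expR Z - 1) - 1.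
have WZ : Z <= W.
  have := expR_ge1Dx Z; have := expR_ge1Dx (expR Z - 1).
  by rewrite /W; lra.
have W0 : 0 < W by rewrite (lt_le_trans _ WZ)// (lt_trans ltr01).
pose t := Num.sqrt W^-1.
have tt : t ^+ 2 = W^-1 by rewrite sqr_sqrtr// invr_ge0 ltW.
have t0 : 0 < t by rewrite sqrtr_gt0 invr_gt0.
exists t.
  rewrite t0/= -(@ltr_pXn2r _ 2%N)// ?nnegrE ?ltW// tt.
  rewrite -[ltRHS]invrK ltf_pV2 ?posrE//.
  by rewrite (lt_le_trans _ WZ)// (lt_trans _ Zd)// ltrDl.
rewrite tt /slog invrK /W addrCA subrr addr0 expRK addrCA subrr addr0 expRK.
by rewrite /Z (periodicn (@sinD2pi R)).
Qed.

Variables (N : nat) (c : R).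
Hypothesis cc : 0 < c <= 16^-1.
Let c0 : 0 < c. Proof. by case/andP: cc. Qed.
Let cc' : 0 <= c <= 16^-1. Proof. by case/andP: cc => /ltW -> ->. Qed.

Lemma dxu_axis t : dxu c (0, t) = 1 + c * sin (ln (slog (t ^+ 2))).
Proof.
rewrite /dxu /dirxx /= !mul0r mulr0 addr0 /phase /nsq/=.
by rewrite expr0n add0r.
Qed.

(** Near the points [(0, t)] the first derivative is [1 + c * sin phase], which by
    [small_phase] equals [1 + c] at points arbitrarily close to [0], and [1 - c] at
    others; by continuity off the singular set it is close to these values on sets
    of positive measure, where it meets any almost everywhere equal function. *)
Lemma Dgrad_discontinuous : (1 <= N)%N -> ~ ae_in_C (eball 0 2) (@Dgrad R m N c).
Proof.
move=> N1 [G cG GE]; pose i : 'I_N := Ordinal N1; pose k := (i, axis1 m).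
have r0 : 0 < 2 / m.+3%:R :> R by rewrite divr_gt0.
have BD : ball (0 : pt) (2 / m.+3%:R) `<=` eball 0 2.
  by rewrite ball_rVE//; apply: box_sub_eball; rewrite ltr0n.
have oB : open (ball (0 : pt) (2 / m.+3%:R)) by exact: ball_open.
have cG0 : {for 0, continuous (G k)}.
  have := continuous_subspaceW BD (cG k).
  rewrite continuous_open_subspace// => /(_ 0); apply.
  by rewrite inE; exact: ballxx.
have c4 : 0 < c / 4 by rewrite divr_gt0.
have := cG0; move=> /(@cvgrPdist_lt _ _ _ (nbhs (0 : pt)))/(_ _ c4).
move=> /nbhs_ballP[d1 /= d10 hd1].
pose d := Num.min d1 (2 / m.+3%:R); have d0 : 0 < d by rewrite lt_min d10.
have val theta : exists2 z : R, `|G k 0 - z| < c / 4 & `|1 + c * sin theta - z| < c / 4.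
  have [t /andP[t0 td] tth] := small_phase theta d0.
  (* On the second coordinate axis [dirxx] vanishes and only the profile is left. *)
  pose y : pt := \row_j (if j == axis2 m then t else 0).
  have py : proj y = (0, t) by rewrite /proj /y !mxE.
  have ry : 0 < rho (proj y) by rewrite -nsq_gt0 py /nsq/= expr0n add0r exprn_gt0.
  have yd : ball 0 d y.
    rewrite ball_rVE//; apply/boxP => j; rewrite !mxE subr0.
    by case: ifP => _; rewrite ?normr0// gtr0_norm.
  have cF := slow_continuous (slow_dxu cc') ry.
  have nb1 : nbhs y (ball 0 d) by apply: open_nbhs_nbhs; split=> //; exact: ball_open.
  have nb2 : nbhs y (fun z => `|dxu c (proj y) - dxu c (proj z)| < c / 4).
    by move: cF => /(@cvgrPdist_lt _ _ _ (nbhs y))/(_ _ c4).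
  have [z [zd zF] Fz] := ae_meets_nbhs GE (filterI nb1 nb2).
  have zd1 : ball 0 d1 z by apply: le_ball zd; rewrite ge_min lexx.
  have zd2 : ball 0 (2 / m.+3%:R) z by apply: le_ball zd; rewrite ge_min lexx orbT.
  exists (G k z); first exact: hd1.
  have := zF; rewrite /= py dxu_axis tth.
  by rewrite -(Fz (BD _ zd2) k).
have [z1 h1 h2] := val (pi / 2).
have [z2 h3 h4] := val (- (pi / 2)).
move: h1 h2 h3 h4; rewrite sinN sin_pihalf.
rewrite !ltr_norml => /andP[? ?] /andP[? ?] /andP[? ?] /andP[? ?].
move: c0; lra.
Qed.

End discontinuity.

(** * Ellipticity and the equation *)

Section Lp_membership.
Variables (R : realType) (n : nat).
Local Notation pt := 'rV[R]_n.
Local Notation leb := (@lebesgue_rV R n).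
Implicit Types (f g : pt -> R) (M : R).

Lemma restrict_eball_bounded (x : pt) r f M : 0 <= M -> measurable_fun setT f ->
  (forall y, eball x r y -> `|f y| <= M) ->
  [/\ measurable_fun setT (f \_ (eball x r)),
      forall y, `|(f \_ (eball x r)) y| <= M &
      forall y, (f \_ (eball x r)) y != 0 -> eball x r y].
Proof.
move=> M0 mf fM; split.
- apply: (measurable_restrict _ (measurable_eball x r) measurableT).1.
  by rewrite setTI; exact: measurable_funTS.
- move=> y; rewrite patchE; case: ifPn => [|_]; last by rewrite normr0.
  by rewrite inE; exact: fM.
- by move=> y; rewrite patchE; case: ifPn => [|_]; [rewrite inE|rewrite eqxx].
Qed.

Lemma in_L2_bounded (x : pt) r f M : 0 <= M -> measurable_fun setT f ->
  (forall y, eball x r y -> `|f y| <= M) -> in_Lp 2%:E (eball x r) f.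
Proof.
move=> M0 mf fM; have [mh hM hD] := restrict_eball_bounded M0 mf fM.
rewrite /in_Lp; set h := f \_ _ in mh hM hD *.
rewrite inE; apply/andP; split; rewrite inE/=; first exact: mh.
rewrite /finite_norm unlock poweR_lty//.
have i2 : leb.-integrable setT (EFin \o (fun y => h y ^+ 2)).
  apply: (@bounded_support_integrable _ _ _ _ (eball x r) _ (M ^+ 2)).
  - exact: measurable_eball.
  - exact: leb_eball_lty.
  - exact: measurable_funX.
  - by move=> y; rewrite normrX ler_pXn2r ?nnegrE.
  - by move=> y; rewrite expf_eq0 /=; exact: hD.
have := integrable_lty measurableT i2; apply: le_lt_trans.
rewrite le_eqVlt; apply/orP; left; apply/eqP.
by apply: eq_integral => y _ /=; rewrite powR_mulrn// real_normK// num_real.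
Qed.

Lemma in_Loo_bounded (x : pt) r f M : 0 <= M -> measurable_fun setT f ->
  (forall y, eball x r y -> `|f y| <= M) -> in_Lp +oo%E (eball x r) f.
Proof.
move=> M0 mf fM; have [mh hM hD] := restrict_eball_bounded M0 mf fM.
rewrite /in_Lp; set h := f \_ _ in mh hM hD *.
rewrite inE; apply/andP; split; rewrite inE/=; first exact: mh.
rewrite /finite_norm unlock; case: ifP => // _.
apply: (@le_lt_trans _ _ M%:E); last exact: ltry.
by apply/ess_supP; apply: aeW => y /=; rewrite lee_fin.
Qed.

Lemma integrable_Rsum (I : finType) (D : set pt) (h : I -> pt -> R) : measurable D ->
  (forall i, leb.-integrable D (EFin \o h i)) ->
  leb.-integrable D (EFin \o (fun x => \sum_i h i x)).
Proof.
move=> mD hi; rewrite (_ : _ \o _ = (fun x => \sum_i (EFin \o h i) x)%E).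
  by apply: integrable_sum => // i _; exact: hi.
by apply/funext => x /=; rewrite sumEFin.
Qed.

Lemma integrable_prod_L2 (D : set pt) f g : measurable D ->
  in_Lp 2%:E D f -> in_Lp 2%:E D g ->
  leb.-integrable D (EFin \o (fun x => f x * g x)).
Proof.
move=> mD Lf Lg; have := Lfun2_mul_Lfun1 Lf Lg.
move=> /Lfun1_integrable h; rewrite integrable_mkcond//.
apply: eq_integrable h => // x _ /=.
by rewrite !patchE; case: ifP => //; rewrite mulr0.
Qed.

Lemma integrable_bounded_mul (D : set pt) f g M : measurable D ->
  measurable_fun setT f -> (forall x, `|f x| <= M) ->
  leb.-integrable D (EFin \o g) -> leb.-integrable D (EFin \o (fun x => f x * g x)).
Proof.
move=> mD mf fM ig.
have := @integrableMr _ _ _ leb D mD f _ (measurable_funTS mf) _ ig.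
apply.
by exists M; split; [exact: num_real|move=> K MK x _; exact: le_trans (fM x) (ltW MK)].
Qed.

End Lp_membership.

Section elliptic_system.
Variables (R : realType) (m N : nat) (c : R).
Hypothesis cc : 0 <= c <= 32^-1.
Local Notation pt := 'rV[R]_m.+2.
Local Notation leb := (@lebesgue_rV R m.+2).
Implicit Types (x : pt) (P : R * R).

Let c0 : 0 <= c. Proof. by case/andP: cc. Qed.
Let cc' : 0 <= c <= 16^-1.
Proof.
apply/andP; split; first exact: c0.
by case/andP: cc => _ /le_trans; apply; rewrite lef_pV2 ?posrE ?ltr0n// ler_nat.
Qed.

Lemma sum_deltal (p : nat) (i : 'I_p) (F : 'I_p -> R) :
  \sum_j (i == j)%:R * F j = F i.
Proof.
rewrite (bigD1 i)//= eqxx mul1r big1 ?addr0// => j /negbTE ji.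
by rewrite eq_sym ji mul0r.
Qed.

Lemma sum_dcoef a P (w : 'I_m.+2 -> R) :
  \sum_b dcoef c a b P * w b = dcoef c a (axis1 m) P * w (axis1 m).
Proof.
rewrite (bigD1 (axis1 m))//= big1 ?addr0// => b /negbTE b0.
by rewrite /dcoef b0 mul0r.
Qed.

Lemma sum_dcoef0 P (w : 'I_m.+2 -> R) :
  \sum_a dcoef c a (axis1 m) P * w a = acol1 c P * w (axis1 m) + acol2 c P * w (axis2 m).
Proof.
rewrite !big_ord_recl big1 ?addr0.
  by rewrite /dcoef !eqxx.
by move=> j _; rewrite /dcoef eqxx /= mul0r.
Qed.

(** Only the first column of the coefficients differs from the identity, and by
    little, so the quadratic form stays close to the square of the norm. *)
Lemma coercive_pointwise P (w : 'I_m.+2 -> R) :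
  2^-1 * \sum_a w a ^+ 2 <=
  \sum_a \sum_b ((a == b)%:R + dcoef c a b P) * w b * w a.
Proof.
have -> : \sum_a \sum_b ((a == b)%:R + dcoef c a b P) * w b * w a =
    \sum_a w a ^+ 2 + (acol1 c P * w (axis1 m) + acol2 c P * w (axis2 m)) * w (axis1 m).
  rewrite -sum_dcoef0 mulr_suml -big_split/=; apply: eq_bigr => a _.
  under eq_bigr do rewrite mulrDl mulrDl.
  rewrite big_split/=; congr (_ + _).
    by rewrite -mulr_suml sum_deltal expr2.
  by rewrite -mulr_suml sum_dcoef mulrAC.
have s0 : 0 < nsq P + 1 by rewrite ltr_wpDl ?nsq_ge0.
have Ps : nsq P <= nsq P + 1 by rewrite lerDl.
have A1 : `|acol1 c P| <= 4^-1.
  have := dcoef_le8 cc' (axis1 m) (axis1 m) P; rewrite /dcoef eqxx.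
  by case/andP: cc; lra.
have A2 : `|acol2 c P| <= 4^-1.
  have := dcoef_le8 cc' (axis2 m) (axis1 m) P; rewrite /dcoef eqxx.
  by case/andP: cc => ? ?; rewrite /=; lra.
have W : w (axis1 m) ^+ 2 + w (axis2 m) ^+ 2 <= \sum_a w a ^+ 2.
  rewrite !big_ord_recl addrA lerDl sumr_ge0// => j _; exact: sqr_ge0.
move: A1 A2; rewrite !ler_norml => /andP[? ?] /andP[? ?].
move: W; set S := \sum_a _; move: (w (axis1 m)) (w (axis2 m)) => p q W.
have e1 : - 4^-1 * p ^+ 2 <= acol1 c P * p ^+ 2 by rewrite ler_wpM2r ?sqr_ge0.
have e2 : - 4^-1 * (p ^+ 2 + q ^+ 2) <= acol2 c P * q * p.
  have h1 := sqr_ge0 (p - q); have h2 := sqr_ge0 (p + q).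
  have [qp|qp] := leP 0 (q * p).
    have : - 4^-1 * (q * p) <= acol2 c P * (q * p) by rewrite ler_wpM2r.
    by nra.
  have : 4^-1 * (q * p) <= acol2 c P * (q * p) by rewrite ler_wnM2r// ltW.
  by nra.
rewrite mulrDl -mulrA -expr2.
by move: e1 e2 W (sqr_ge0 q); lra.
Qed.

Lemma sum_Acoef (i : 'I_N) a b x (F : 'I_N -> R) :
  \sum_j Acoef c (i, j, a, b) x * F j = ((a == b)%:R + dcoef c a b (proj x)) * F i.
Proof.
under eq_bigr do rewrite /= -mulrA.
exact: (sum_deltal i (fun j => ((a == b)%:R + dcoef c a b (proj x)) * F j)).
Qed.

Lemma coercive (Dphi : 'I_N * 'I_m.+2 -> pt -> R) (D : set pt) : measurable D ->
  (forall k, in_Lp 2%:E D (Dphi k)) ->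
  2^-1 * \int[leb]_(x in D) (enorm (Dphi ^~ x) ^+ 2) <=
  \int[leb]_(x in D) (\sum_a \sum_b \sum_i \sum_j
     Acoef c (i, j, a, b) x * Dphi (j, b) x * Dphi (i, a) x).
Proof.
move=> mD L2.
have isq : leb.-integrable D (EFin \o (fun x => enorm (Dphi ^~ x) ^+ 2)).
  rewrite (_ : (fun x => _) = (fun x => \sum_k Dphi k x * Dphi k x)).
    by apply: integrable_Rsum => // k; exact: integrable_prod_L2.
  by apply/funext => x; rewrite enorm_sqr; apply: eq_bigr => k _; rewrite expr2.
rewrite -RintegralZl//; apply: le_Rintegral => //.
- exact: (integrableZl mD (2^-1) isq).
- apply: integrable_Rsum => // a; apply: integrable_Rsum => // b.
  apply: integrable_Rsum => // i; apply: integrable_Rsum => // j.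
  rewrite (_ : (fun x => _) =
      (fun x => Acoef c (i, j, a, b) x * (Dphi (j, b) x * Dphi (i, a) x))).
    apply: (integrable_bounded_mul (M := 2)) => //.
    + exact: Acoef_measurable.
    + by move=> x; exact: Acoef_le2.
    + exact: integrable_prod_L2.
  by apply/funext => x; rewrite mulrA.
move=> x Dx; rewrite enorm_sqr.
have -> : \sum_k Dphi k x ^+ 2 = \sum_i \sum_a Dphi (i, a) x ^+ 2.
  by rewrite pair_big/=; apply: eq_bigr => -[i a].
have -> : \sum_a \sum_b \sum_i \sum_j
     Acoef c (i, j, a, b) x * Dphi (j, b) x * Dphi (i, a) x =
  \sum_i \sum_a \sum_b ((a == b)%:R + dcoef c a b (proj x)) *
     Dphi (i, b) x * Dphi (i, a) x.
  rewrite [RHS]exchange_big/=; apply: eq_bigr => a _.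
  rewrite [RHS]exchange_big/=; apply: eq_bigr => b _.
  apply: eq_bigr => i _; rewrite -mulr_suml.
  by rewrite (sum_Acoef i a b x (fun j => Dphi (j, b) x)).
rewrite mulr_sumr; apply: ler_sum => i _.
exact: (coercive_pointwise (proj x) (fun a => Dphi (i, a) x)).
Qed.

(** [acol1E] and [acol2E] identify the flux with the rotated gradient of [v]. *)
Lemma flux_divergence_free : weak_solution (@Dom R m) (@Acoef R m N c) (@Dgrad R m N c).
Proof.
move=> i phi tphi.
have tdphi a := test_fun_pderiv a tphi.
have idphi a : leb.-integrable (@Dom R m) (EFin \o pderiv a phi).
  have [M HM] := test_fun_bounded (tdphi a).
  apply: (integrable_eball (M := M)); first exact: test_fun_measurable (tdphi a).
  by move=> y _; exact: HM.
have mD : measurable (@Dom R m) by exact: measurable_eball.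
have iflux a (f : R * R -> R) : slow 66 f ->
    leb.-integrable (@Dom R m) (EFin \o (fun x => (f \o @proj R m) x * pderiv a phi x)).
  move=> sf; apply: (integrable_bounded_mul (M := 66)) => //.
    exact: slow_measurable sf.
  by move=> x; exact: slow_bound sf _.
rewrite -[RHS](rotated_gradient_divergence_free (weak_pderiv_sol_v1 cc')
  (weak_pderiv_sol_v2 cc') tphi mD (iflux _ _ (slow_dyv cc')) (iflux _ _ (slow_dyu cc'))).
apply: eq_Rintegral => x _.
have E a : \sum_b \sum_j Acoef c (i, j, a, b) x * Dgrad c (j, b) x * pderiv a phi x =
   (grad c a (proj x) + dcoef c a (axis1 m) (proj x) * dxu c (proj x)) * pderiv a phi x.
  under eq_bigr do rewrite -mulr_suml (sum_Acoef i a _ x (fun j => Dgrad c (j, _) x)).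
  rewrite -mulr_suml; congr (_ * _); rewrite /Dgrad/=.
  under eq_bigr do rewrite mulrDl.
  rewrite big_split/= sum_deltal; congr (_ + _).
  rewrite (sum_dcoef a (proj x) (fun b => grad c b (proj x))).
  by congr (_ * _); rewrite /grad eqxx.
under eq_bigr do rewrite E.
rewrite 2!big_ord_recl big1 ?addr0; last first.
  by move=> j _; rewrite /grad /dcoef eqxx/= mul0r addr0 mul0r.
have aux (A B p q w X Y : R) : (1 + A) * p = w -> B * p + q = - q ->
    (p + A * p) * X + (q + B * p) * Y = w * X - q * Y.
  by move=> <- e; rewrite [q + _]addrC e; ring.
exact: (aux _ _ _ _ _ _ _ (acol1E (proj x) cc') (acol2E (proj x) cc')).
Qed.

End elliptic_system.

(** * The theorem *)

Lemma small_amplitude (R : realType) (K C : R) : 0 <= K -> 0 < C ->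
  exists2 c : R, 0 < c <= 32^-1 & 6 * (K * c) * C <= 1.
Proof.
move=> K0 C0; pose B := 6 * (K + 1) * C.
have K1 : 0 < K + 1 by rewrite ltr_wpDl.
have B0 : 0 < B by rewrite /B mulr_gt0// mulr_gt0.
exists (Num.min 32^-1 B^-1).
  by rewrite lt_min !invr_gt0 ltr0n B0 ge_min lexx.
set c := Num.min _ _.
have c0 : 0 < c by rewrite lt_min !invr_gt0 ltr0n B0.
have cB : c * B <= 1.
  have h : c <= B^-1 by rewrite ge_min lexx orbT.
  by rewrite -(mulVf (lt0r_neq0 B0)) ler_pM2r.
apply: le_trans cB; rewrite /B.
have : 0 <= 6 * c * C by rewrite !mulr_ge0// ltW.
have -> : c * (6 * (K + 1) * C) = 6 * (K * c) * C + 6 * c * C by ring.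
by rewrite lerDl.
Qed.

Theorem proposition1p6 (R : realType) (Cstar : nat -> nat -> R -> R -> R)
    (Cstar_gt0 : forall (n N : nat) (Lambda lambda : R), (2 <= n)%N ->
      (1 <= N)%N -> 0 < Lambda -> 0 < lambda -> 0 < Cstar n N Lambda lambda)
    (n N : nat) (n_ge2 : (2 <= n)%N) (N_ge1 : (1 <= N)%N) :
  exists (lambda Lambda : R) (A : coeffs R n N)
    (u : 'I_N -> 'rV[R]_n -> R) (Du : 'I_N * 'I_n -> 'rV[R]_n -> R),
    0 < lambda /\ 0 < Lambda /\
    in_C (eclosed_ball 0 4) A /\
    {ae @lebesgue_rV R n, forall x, eball 0 4 x -> enorm (A ^~ x) <= Lambda} /\
    (forall (phi : 'I_N -> 'rV[R]_n -> R) (Dphi : 'I_N * 'I_n -> 'rV[R]_n -> R),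
       H10 (eball 0 4) phi Dphi ->
       lambda * \int[lebesgue_rV R n]_(x in eball 0 4) (enorm (Dphi ^~ x) ^+ 2) <=
       \int[lebesgue_rV R n]_(x in eball 0 4)
         (\sum_a \sum_b \sum_i \sum_j
            A (i, j, a, b) x * Dphi (j, b) x * Dphi (i, a) x)) /\
    limf_esup (fun r : R =>
      (r * \int[lebesgue_measure]_(t in `[r, 2])
         (omega2 A t / t ^+ 2 *
          expR (Cstar n N Lambda lambda *
            \int[lebesgue_measure]_(s in `[t, 2]) (omega2 A s / s))))%:E)
      0^'+ = 0%E /\
    H1 (eball 0 4) u Du /\
    weak_solution (eball 0 4) A Du /\
    (forall k, in_Lp +oo%E (eball 0 4) (Du k)) /\
    VMO (eball 0 4) Du /\
    ~ ae_in_C (eball 0 2) Du.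
Proof.
case: n n_ge2 => [//|[//|m]] n_ge2.
pose Lambda : R := ncoef R m N * 2 + 1.
have nI0 : 0 <= ncoef R m N by exact: ler0n.
have Lambda0 : 0 < Lambda by rewrite ltr_wpDl// mulr_ge0.
have lambda0 : 0 < 2^-1 :> R by rewrite invr_gt0.
have C0 := Cstar_gt0 m.+2 N Lambda 2^-1 n_ge2 N_ge1 Lambda0 lambda0.
have K0 : 0 <= ncoef R m N * osc_const R by apply: mulr_ge0 => //; exact: osc_const_ge0.
have [c /andP[c0 c32] cC] := small_amplitude K0 C0.
have c16 : c <= 16^-1.
  by apply: le_trans c32 _; rewrite lef_pV2 ?posrE ?ltr0n// ler_nat.
have cc : 0 <= c <= 16^-1 by rewrite ltW.
have cc32 : 0 <= c <= 32^-1 by rewrite ltW.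
have c16' : 0 < c <= 16^-1 by rewrite c0.
(* [Lambda] and [1 / 2], hence the value of [Cstar], were fixed before [c]. *)
exists 2^-1, Lambda, (Acoef (N := N) c), (fun _ => sol_u (m := m) c), (Dgrad (N := N) c).
have mg k := @Dgrad_measurable R m N c cc k.
have bg k (x : 'rV[R]_m.+2) (_ : eball 0 4 x) := @Dgrad_le R m N c cc k x.
split; first exact: lambda0.
split; first exact: Lambda0.
split; first by move=> k; apply: continuous_subspaceT; exact: Acoef_continuous.
split.
  apply: aeW => x _; apply: (@le_trans _ _ (ncoef R m N * 2)); last by rewrite lerDl.
  by apply: enorm_le => // k; exact: Acoef_le2.
split.
  by move=> phi Dphi [[_ L2 _] _]; apply: coercive => //; exact: measurable_eball.
split.
  apply: (@dini_limsup R _ (ncoef R m N * (c * osc_const R))) => //.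
  - by apply: mulr_ge0 => //; apply: mulr_ge0; [exact: ltW|exact: osc_const_ge0].
  - by rewrite [c * _]mulrC [ncoef R m N * _]mulrA; exact: cC.
  - by move=> t tt; exact: Acoef_omega.
split.
  split=> [i|k|i a].
  - apply: (in_L2_bounded (M := 66)); [exact: ler0n|exact: measurable_sol_u|].
    by move=> y Dy; exact: (norm_sol_u cc Dy).
  - by apply: (in_L2_bounded (M := 66)); [exact: ler0n|exact: mg|exact: bg].
  - exact: weak_pderiv_sol_u.
split; first exact: flux_divergence_free.
split.
  by move=> k; apply: (in_Loo_bounded (M := 66)); [exact: ler0n|exact: mg|exact: bg].
split; first exact: Dgrad_VMO.
exact: Dgrad_discontinuous.
Qed.
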